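(* Let $\alpha_1<\alpha_2<\alpha_3$ be real numbers and let $\rho_1,\rho_2,\rho_3>0$ be real numbers. For each integer $k\ge 1$ let $\nu_1^{(k)},\dots,\nu_{k+1}^{(k)}$ be the Van Vleck zeros of order $k$, and let $$p_{k+1}(x)=\prod_{i=1}^{k+1}\left(x-\nu_i^{(k)}\right)$$ be the corresponding spectral polynomial, of degree $k+1$. Then the spectral polynomials are not orthogonal with respect to any measure. That is, there is no nonzero positive Borel measure $m$ on $\mathbb{R}$ with all moments finite such that, for every $n\ge 2$, $\int_{\mathbb{R}} p_n(x)\,q(x)\,dm(x)=0$ for all polynomials $q$ of degree less than $n$.
   Context: Given real $\alpha_1<\alpha_2<\alpha_3$ and real $\rho_1,\rho_2,\rho_3>0$, set $$A(x)=\prod_{j=1}^3(x-\alpha_j),\qquad B(x)=\sum_{j=1}^3 2\rho_j\prod_{i\neq j}(x-\alpha_i).$$ The Lamé equation is $A(x)\phi''+B(x)\phi'=\mu(x-\nu)\phi$. For an integer $k\ge 1$, the Van Vleck zeros of order $k$ are all the numbers $\nu$ such that, for some constant $\mu$, this equation has a polynomial solution $\phi$ of degree exactly $k$ (necessarily $\mu=k(k-1+2(\rho_1+\rho_2+\rho_3))$). It is a known fact (Heine, Van Vleck) that there are exactly $k+1$ distinct Van Vleck zeros of order $k$, and that they are all real and lie in $(\alpha_1,\alpha_3)$. *)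

(* Defs.v *)
From HB Require Import structures.
From mathcomp Require Import all_boot all_order all_algebra.
From mathcomp Require Import all_classical all_reals all_analysis.
From mathcomp Require Import complex.

Set Implicit Arguments.
Unset Strict Implicit.
Unset Printing Implicit Defensive.

Import Order.TTheory GRing.Theory Num.Theory.

Local Open Scope ring_scope.

Definition lame_A (R : realType) (alpha : 'I_3 -> R) : {poly R} :=
  \prod_(j < 3) ('X - (alpha j)%:P).

Definition lame_B (R : realType) (alpha rho : 'I_3 -> R) : {poly R} :=
  \sum_(j < 3) (2 * rho j) *: \prod_(i < 3 | i != j) ('X - (alpha i)%:P).

(* A priori the Van Vleck zero, the constant mu and the solution phi are
   complex; the Lame equation is an identity of polynomials over R[i]. *)
Definition van_vleck_zero (R : realType) (alpha rho : 'I_3 -> R) (k : nat)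
    (nu : R[i]) : Prop :=
  exists (mu : R[i]) (phi : {poly R[i]}),
    size phi = k.+1 /\
    map_poly (real_complex R) (lame_A alpha) * phi^`(2) +
      map_poly (real_complex R) (lame_B alpha rho) * phi^`() =
    mu *: (('X - nu%:P) * phi).

(* nu lists the Van Vleck zeros of order k, without repetition.  By the
   theorem of Heine and Van Vleck such a list of k + 1 real numbers exists
   for every k >= 1; it is unique up to reordering. *)
Definition van_vleck_zeros (R : realType) (alpha rho : 'I_3 -> R) (k : nat)
    (nu : 'I_k.+1 -> R) : Prop :=
  injective nu /\
  forall z : R[i],
    van_vleck_zero alpha rho k z <-> exists i, z = real_complex R (nu i).

(* The polynomial p_(k+1), of degree k + 1. *)
Definition spectral_poly (R : realType) (k : nat) (nu : 'I_k.+1 -> R) :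
    {poly R} :=
  \prod_(i < k.+1) ('X - (nu i)%:P).

(* Main.v *)
Require Import Defs.
From HB Require Import structures.
From mathcomp Require Import all_boot all_order all_algebra.
From mathcomp Require Import all_classical all_reals all_analysis.
From mathcomp Require Import complex polyorder polyrcf.
From mathcomp Require Import zify ring lra.

Set Implicit Arguments.
Unset Strict Implicit.
Unset Printing Implicit Defensive.

Import Order.TTheory GRing.Theory Num.Theory.
Import numFieldNormedType.Exports.

Local Open Scope classical_set_scope.
Local Open Scope ring_scope.

(** Let [L q] be the integral of [q], a linear functional on polynomials with
   [0 <= L (q * q)] and [L 1 != 0], and let [P k] be the spectral polynomial of
   order [k].  Orthogonality leaves two possibilities.

   If some nonzero [q] has [L (q * q) = 0] (the measure is finitely supported),
   division with remainder shows that the [q] of least degree divides all [P k]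
   with [k] large ([degenerate_common_divisor]), so that one number [a] is a Van
   Vleck zero of every large order.  This contradicts Sturm theory.  For two
   solutions of the Lame equation with the same [a] and different [mu], the
   combination [phi1' phi2 / mu1 - phi1 phi2' / mu2] satisfies a first-order
   equation from which [a] has disappeared; hence in each of the two intervals
   between consecutive singular points the critical points of [phi1] and the end
   points are separated by critical points of [phi2]
   ([size_critical_points_lt]).  Each interval thus gains a critical point
   whenever [k] grows by one, that is at least two in all, whereas [phi'] only
   has degree [k - 1] ([no_common_van_vleck_zero]).

   Otherwise [L] is positive definite and the [P k] satisfy a three-term
   recurrence [P (k + 1) = ('X - b k) * P k - c k *: P (k - 1)] for [k >= 2]
   ([three_term_recurrence]).  Power sums of the roots are traces of powers of a
   banded matrix, in two ways.  On the one hand, the coefficients of a solution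
   of the Lame equation, computed from the top, present [P k] as the last term
   of an explicit recurrence ([spectral_poly_lame_rec]); with the singular points
   centred at [0] and [lame_A = 'X^3 + p 'X + q] this gives for the power sums
   [S1], [S2] and [S4] of the Van Vleck zeros of order [k]
   [[
     S1 = const + O(1/k),   S2 = - 4/15 p k + const + O(1/k),
     S4 = 16/105 p^2 k + O(1).
   ]]
   On the other hand, the recurrence in [k] expresses the increments of [S1],
   [S2] and [S4] through [b] and [c]: the first two force [b k] to tend to [0] and
   [c k] to [- 2/15 p], and the last one then yields [S4 = 8/75 p^2 k + o(k)].
   Since [16/105] and [8/75] differ, [p = 0]; but [p] is minus half the sum of the
   squares of the three distinct singular points. *)

(** * The integrating factor of the Lame operator *)

Lemma is_derive_powR_dist (R : realType) (a r x : R) : 0 < r -> x != a ->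
  is_derive x 1 (fun y : R => `|y - a| `^ r) (`|x - a| `^ r * (r / (x - a))).
Proof.
move=> r0 xa.
have xa0 : x - a != 0 by rewrite subr_eq0.
have n0 : 0 < `|x - a| by rewrite normr_gt0.
pose s : R := Num.sg (x - a).
have ns1 : `|s| = 1 by rewrite normr_sg xa0.
pose L : {poly R} := s *: ('X - a%:P).
have LE y : L.[y] = s * (y - a) by rewrite /L !hornerE.
have sE : `|x - a| = L.[x] by rewrite LE normrEsg.
have d1 : is_derive x 1 (horner L) s.
  apply: (is_derive_eq (is_derive_poly L x)).
  by rewrite /L derivZ derivXsubC !hornerE.
have ns : 0 < L.[x] by rewrite -sE.
have d2 := @is_derive1_powR R r L.[x] ns.
have d3 := @is_derive1_comp R _ _ x _ _ d2 d1.
have d4 : is_derive x 1 (fun y : R => `|y - a| `^ r) (r * L.[x] `^ (r - 1) * s).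
  apply: near_eq_is_derive d3.
  have : \forall y \near x, 0 < L.[y].
    exact: (cvgr_gt _ (@continuous_horner R L x)).
  apply: filterS => y Ly /=.
  by rewrite -[LHS]/(L.[y] `^ r) -(gtr0_norm Ly) LE normrM ns1 mul1r.
apply: (is_derive_eq d4).
have s2 : s * (x - a) != 0 by rewrite -LE gt_eqF.
rewrite sE -[in RHS](@mulr_powRB1 _ L.[x] r) ?(ltW ns) // {2}LE.
by field.
Qed.

Lemma continuous_powR_dist (R : realType) (a r : R) : 0 < r ->
  continuous (fun y : R => `|y - a| `^ r).
Proof.
move=> r0 x; have [->|xa] := eqVneq x a; last first.
  have [/derivable1_diffP /differentiable_continuous] :=
    is_derive_powR_dist r0 xa.
  by [].
apply/cvgrPdist_lt => e e0; rewrite subrr normr0 powR0 ?gt_eqF //.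
near=> y; rewrite sub0r normrN ger0_norm ?powR_ge0 //.
have -> : e = (e `^ r^-1) `^ r.
  by rewrite -powRrM mulVf ?gt_eqF // powRr1 // ltW.
apply: gt0_ltr_powR => //; rewrite ?nnegrE ?powR_ge0 // distrC.
near: y; apply: (@cvgr_dist_lt _ _ _ (nbhs a)); last exact: powR_gt0.
exact: cvg_id.
Unshelve. all: by end_near. Qed.

(** The integrating factor of [A W' + B W]: the derivative of [lame_weight * W]
   is [lame_weight / A] times that expression. *)
Definition lame_weight (R : realType) (alpha rho : 'I_3 -> R) (x : R) : R :=
  \prod_(j < 3) `|x - alpha j| `^ (2 * rho j).

Lemma lame_weight_root (R : realType) (alpha rho : 'I_3 -> R) j :
  0 < rho j -> lame_weight alpha rho (alpha j) = 0.
Proof.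
move=> rj; rewrite /lame_weight (bigD1 j) //= subrr normr0 powR0 ?mul0r //.
by rewrite mulf_neq0 ?gt_eqF.
Qed.

Lemma lame_weight_ge0 (R : realType) (alpha rho : 'I_3 -> R) x :
  0 <= lame_weight alpha rho x.
Proof. by apply: prodr_ge0 => j _; exact: powR_ge0. Qed.

Lemma lame_weight_gt0 (R : realType) (alpha rho : 'I_3 -> R) x :
  (lame_A alpha).[x] != 0 -> 0 < lame_weight alpha rho x.
Proof.
move=> Ax; apply: prodr_gt0 => j _; apply: powR_gt0; rewrite normr_gt0 subr_eq0.
apply: contraNneq Ax => ->.
by rewrite /lame_A (bigD1 j) //= hornerM hornerXsubC subrr mul0r.
Qed.

Lemma lame_weightE (R : realType) (alpha rho : 'I_3 -> R) :
  let w j := fun y => `|y - alpha j| `^ (2 * rho j) in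
  lame_weight alpha rho =
    w ord0 * w (lift ord0 ord0) * w (lift ord0 (lift ord0 ord0)).
Proof.
by apply/funext => y; rewrite /lame_weight !big_ord_recl big_ord0 mulr1 mulrA.
Qed.

Lemma lame_AE (R : realType) (alpha : 'I_3 -> R) :
  lame_A alpha = ('X - (alpha ord0)%:P) * ('X - (alpha (lift ord0 ord0))%:P) *
    ('X - (alpha (lift ord0 (lift ord0 ord0)))%:P).
Proof. by rewrite /lame_A !big_ord_recl big_ord0 mulr1 mulrA. Qed.

Lemma lame_BE (R : realType) (alpha rho : 'I_3 -> R) :
  let a1 := alpha ord0 in
  let a2 := alpha (lift ord0 ord0) in
  let a3 := alpha (lift ord0 (lift ord0 ord0)) in
  lame_B alpha rho =
    (2 * rho ord0) *: (('X - a2%:P) * ('X - a3%:P)) +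
    (2 * rho (lift ord0 ord0)) *: (('X - a1%:P) * ('X - a3%:P)) +
    (2 * rho (lift ord0 (lift ord0 ord0))) *: (('X - a1%:P) * ('X - a2%:P)).
Proof.
rewrite /lame_B !big_ord_recl big_ord0 addr0 /= addrA.
by do 3 (rewrite (big_mkcond (fun i => i != _)) /= !big_ord_recl big_ord0 /=
  ?mulr1 ?mul1r).
Qed.

Lemma continuous_lame_weight (R : realType) (alpha rho : 'I_3 -> R) :
  (forall j, 0 < rho j) -> continuous (lame_weight alpha rho).
Proof.
move=> hrho x.
have c j : {for x, continuous (fun y => `|y - alpha j| `^ (2 * rho j))}.
  by apply: continuous_powR_dist; rewrite mulr_gt0.
rewrite /continuous_at lame_weightE; apply: cvgM; [apply: cvgM|]; exact: c.
Qed.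

Lemma is_derive_lame_weight (R : realType) (alpha rho : 'I_3 -> R) (x : R) :
  (forall j, 0 < rho j) -> (lame_A alpha).[x] != 0 ->
  is_derive x 1 (lame_weight alpha rho)
    (lame_weight alpha rho x * ((lame_B alpha rho).[x] / (lame_A alpha).[x])).
Proof.
move=> hrho; rewrite lame_AE lame_BE !hornerE !mulf_eq0 !negb_or.
move=> /andP[/andP[x1 x2] x3].
have d j : x - alpha j != 0 -> is_derive x 1
    (fun y : R => `|y - alpha j| `^ (2 * rho j))
    (`|x - alpha j| `^ (2 * rho j) * (2 * rho j / (x - alpha j))).
  by rewrite subr_eq0; apply: is_derive_powR_dist; rewrite mulr_gt0.
have H := is_deriveM (is_deriveM (d _ x1) (d _ x2)) (d _ x3).

rewrite lame_weightE; apply: (is_derive_eq H).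
rewrite /GRing.scale /= -![(_ * _) x]/(_ x * _ x).
by cbv beta; field; rewrite x1 x2 x3.
Qed.

(** On an interval free of singular points the product of the weight and of a
   polynomial whose logarithmic-type derivative [A W' + B W] has the sign of [A]
   increases; the weight vanishes at the singular points, so these are allowed
   as end points. *)
Lemma ltr_lame_weight (R : realType) (alpha rho : 'I_3 -> R)
    (W : {poly R}) (h : R -> R) (c d : R) :
  (forall j, 0 < rho j) -> c < d ->
  (forall x, c < x < d -> (lame_A alpha).[x] != 0) ->
  (forall x, c < x < d -> 0 < h x) ->
  (forall x, c < x < d ->
     (lame_A alpha * W^`() + lame_B alpha rho * W).[x] =
     (lame_A alpha).[x] * h x) ->
  lame_weight alpha rho c * W.[c] < lame_weight alpha rho d * W.[d].
Proof.
move=> hrho cd A0 h0 hW; rewrite -subr_gt0.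
pose f : R -> R := lame_weight alpha rho * horner W.
have [||z] := @MVT R f (fun x => lame_weight alpha rho x * h x) c d cd.
- move=> x; rewrite in_itv /= => cxd.
  have A0x := A0 _ cxd.
  have H := is_deriveM (is_derive_lame_weight hrho A0x) (is_derive_poly W x).
  apply: (is_derive_eq H).
  have := hW _ cxd; rewrite !hornerE => E.
  rewrite /GRing.scale /= => {H}; apply: (mulfI A0x).
  by rewrite [RHS]mulrCA -E; field.
- apply: continuous_subspaceT => x; apply: cvgM.
    exact: continuous_lame_weight.
  exact: continuous_horner.
rewrite in_itv /= => czd E.
rewrite -[X in 0 < X]/(f d - f c) E mulr_gt0 ?subr_gt0 //.
by rewrite mulr_gt0 ?h0 // lame_weight_gt0 // A0.
Qed.

(** * Sturm comparison of the critical points of two solutions *)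

Definition lame_solution (R : realType) (alpha rho : 'I_3 -> R) (mu a : R)
    (phi : {poly R}) : Prop :=
  lame_A alpha * phi^`(2) + lame_B alpha rho * phi^`() =
  mu *: (('X - a%:P) * phi).

Lemma lame_solutionZ (R : realType) (alpha rho : 'I_3 -> R) mu a phi s :
  lame_solution alpha rho mu a phi -> lame_solution alpha rho mu a (s *: phi).
Proof.
rewrite /lame_solution => E.
by rewrite derivnZ derivZ -!scalerAr -scalerDr E scalerA mulrC -scalerA.
Qed.

Lemma lame_solution_horner (R : realType) (alpha rho : 'I_3 -> R) mu a phi x :
  lame_solution alpha rho mu a phi ->
  (lame_A alpha).[x] * phi^`()^`().[x] + (lame_B alpha rho).[x] * phi^`().[x] =
  mu * ((x - a) * phi.[x]).
Proof.
by move=> /(congr1 (horner^~ x)); rewrite -[phi^`(2)]/(phi^`()^`()) !hornerE.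
Qed.

(** At a regular point the equation determines all derivatives from [phi] and
   [phi^`()]; here this appears as a comparison of multiplicities: at a
   common zero, [phi^`()] and [phi] vanish to higher order than [phi^`(2)]. *)
Lemma lame_solution_simple_roots (R : realType) (alpha rho : 'I_3 -> R) mu a
    phi x :
  lame_solution alpha rho mu a phi -> (lame_A alpha).[x] != 0 ->
  phi^`() != 0 -> phi.[x] = 0 -> phi^`().[x] != 0.
Proof.
move=> E Ax dphi0 phix; apply/negP => dphix.
have phi0 : phi != 0 by apply: contraNneq dphi0 => ->; rewrite deriv0.
have ddphi0 : phi^`()^`() != 0.
  apply: contraNneq dphi0 => d0.
  have /size1_polyC Ec : (size phi^`() <= 1)%N.
    by rewrite -subn_eq0 subn1 -size_deriv d0 size_poly0.
  by move: dphix; rewrite Ec hornerC polyC_eq0.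
have A0 : lame_A alpha != 0 by apply: contraNneq Ax => ->; rewrite horner0.
have m1 := mu_deriv_root phi0 (introT eqP phix : root phi x).
have m2 := mu_deriv_root dphi0 dphix.
have AE : lame_A alpha * phi^`()^`() != 0 by rewrite mulf_neq0.
have : ('X - x%:P) ^+ (\mu_x (phi^`())) %| lame_A alpha * phi^`()^`().
  have -> : lame_A alpha * phi^`()^`() =
      mu *: (('X - a%:P) * phi) - lame_B alpha rho * phi^`().
    by rewrite -E addrK.
  have [->|mu0] := eqVneq mu 0.
    by rewrite scale0r sub0r dvdpNr dvdp_mull ?root_mu.
  rewrite dvdp_sub // ?dvdp_mull ?root_mu // dvdpZr // dvdp_mull //.
  by rewrite root_le_mu // m1 leq_addr.
rewrite root_le_mu // mu_mul // (muNroot Ax) m2.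
by rewrite add0n addn1 ltnn.
Qed.

Lemma noroot_sign (R : realType) (p : {poly R}) (c d : R) : c < d ->
  (forall x, c < x < d -> ~~ root p x) ->
  exists2 s : R, s != 0 & forall x, c < x < d -> 0 < (s *: p).[x].
Proof.
move=> cd nr; pose m := (c + d) / 2.
have cmd : c < m < d by rewrite /m; lra.
exists p.[m]; first exact: nr.
move=> x cxd; rewrite hornerZ -sgr_gt0 sgrM.
have -> : Num.sg p.[x] = Num.sg p.[m].
  by apply: (@polyrN0_itv _ `]c, d[) => [z||]; rewrite ?in_itv //=; apply: nr.
by rewrite -expr2 sqr_sg nr.
Qed.

Lemma horner_ge0_left (R : realType) (p : {poly R}) (c d : R) : c < d ->
  (forall x, c < x < d -> 0 < p.[x]) -> 0 <= p.[c].
Proof.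
move=> cd p0; rewrite leNgt; apply/negP => pc.
pose m := (c + d) / 2.
have [cm md] : c < m /\ m < d by rewrite /m; lra.
have [|z] := @poly_ivtoo _ p c m (ltW cm).
  by rewrite nmulr_rlt0 // p0 // cm.
rewrite in_itv /= => /andP[cz zm] /eqP pz.
by have := p0 z; rewrite cz (lt_trans zm) // pz ltxx => /(_ isT).
Qed.

Lemma horner_ge0_right (R : realType) (p : {poly R}) (c d : R) : c < d ->
  (forall x, c < x < d -> 0 < p.[x]) -> 0 <= p.[d].
Proof.
move=> cd p0; rewrite leNgt; apply/negP => pc.
pose m := (c + d) / 2.
have [cm md] : c < m /\ m < d by rewrite /m; lra.
have [|z] := @poly_ivtoo _ p m d (ltW md).
  by rewrite pmulr_rlt0 // p0 // cm.
rewrite in_itv /= => /andP[cz zm] /eqP pz.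
by have := p0 z; rewrite zm (lt_trans cm) // pz ltxx => /(_ isT).
Qed.

Lemma deriv_ge0_left (R : realType) (p : {poly R}) (c d : R) : c < d ->
  p.[c] = 0 -> (forall x, c < x < d -> 0 < p.[x]) -> 0 <= p^`().[c].
Proof.
move=> cd /eqP /factor_theorem [q ->] p0.
rewrite derivM derivXsubC !hornerE subrr mulr0 add0r.
apply: (horner_ge0_left cd) => x /[dup] /andP[cx _] /p0.
by rewrite !hornerE pmulr_lgt0 // subr_gt0.
Qed.

Lemma deriv_le0_right (R : realType) (p : {poly R}) (c d : R) : c < d ->
  p.[d] = 0 -> (forall x, c < x < d -> 0 < p.[x]) -> p^`().[d] <= 0.
Proof.
move=> cd /eqP /factor_theorem [q ->] p0.
rewrite derivM derivXsubC !hornerE subrr mulr0 add0r -oppr_ge0 -hornerN.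
apply: (horner_ge0_right cd) => x /[dup] /andP[_ xd] /p0.
by rewrite !hornerE nmulr_lgt0 ?subr_lt0 // oppr_gt0.
Qed.

(** A critical point of a solution lies where the equation is oscillatory, that
   is where [A (x - a) < 0].  Otherwise [x - a] has the sign of [A] all the way
   to one of the two neighbouring singular points, and there the derivative of
   [lame_weight * (phi * phi^`())] is positive although this product vanishes
   at both ends. *)
Lemma critical_point_oscillatory (R : realType) (alpha rho : 'I_3 -> R) mu a phi
    (i j : 'I_3) y :
  (forall j, 0 < rho j) -> lame_solution alpha rho mu a phi -> 0 < mu ->
  phi^`() != 0 ->
  (forall x, alpha i < x < alpha j -> (lame_A alpha).[x] != 0) ->
  alpha i < y < alpha j -> phi^`().[y] = 0 -> (lame_A alpha).[y] * (y - a) < 0.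
Proof.
move=> hrho E mu0 dphi0 A0 cyd dphiy; rewrite ltNge; apply/negP => Aya.
have [cy yd] := andP cyd.
pose W := phi * phi^`().
pose h x :=
  phi^`().[x] ^+ 2 + mu * ((x - a) / (lame_A alpha).[x]) * phi.[x] ^+ 2.
have hW x : alpha i < x < alpha j ->
    (lame_A alpha * W^`() + lame_B alpha rho * W).[x] =
    (lame_A alpha).[x] * h x.
  move=> cxd; have := lame_solution_horner x E; have := A0 _ cxd.
  rewrite /W /h derivM !(hornerD, hornerN, hornerM, hornerZ) => Ax Ex.
  transitivity (phi.[x] * ((lame_A alpha).[x] * phi^`()^`().[x] +
    (lame_B alpha rho).[x] * phi^`().[x]) +
    (lame_A alpha).[x] * phi^`().[x] ^+ 2).
    by ring.
  by rewrite Ex; field.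
have h0 x : alpha i < x < alpha j -> 0 < (lame_A alpha).[x] * (x - a) ->
    0 < h x.
  move=> cxd Axa; have Ax := A0 _ cxd.
  have q0 : 0 < mu * ((x - a) / (lame_A alpha).[x]).
    rewrite mulr_gt0 //.
    have -> : (x - a) / (lame_A alpha).[x] =
        (lame_A alpha).[x] * (x - a) / (lame_A alpha).[x] ^+ 2 by field.
    by rewrite divr_gt0 // exprn_even_gt0.
  have [px|px] := eqVneq phi.[x] 0.
    rewrite /h px expr0n mulr0 addr0 exprn_even_gt0 //=.
    exact: lame_solution_simple_roots E Ax dphi0 px.
  by rewrite /h ltr_wpDl ?sqr_ge0 // mulr_gt0 // exprn_even_gt0.
have Wy : W.[y] = 0 by rewrite hornerM dphiy mulr0.
have nrA x : x \in `]alpha i, alpha j[ -> ~~ root (lame_A alpha) x.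
  by rewrite in_itv /=; apply: A0.
have sgA x : alpha i < x < alpha j ->
    Num.sg (lame_A alpha).[x] = Num.sg (lame_A alpha).[y].
  move=> cxd; apply: (polyrN0_itv nrA); rewrite in_itv //.
have [Ay|Ay|/eqP] := ltrgt0P (lame_A alpha).[y];
  last by rewrite (negPf (A0 _ cyd)).
- have ya : a <= y by move: Aya; rewrite pmulr_rge0 // subr_ge0.
  have := @ltr_lame_weight _ alpha rho W h y (alpha j) hrho yd.
  rewrite Wy lame_weight_root // mul0r mulr0 ltxx => H.
  have cx x : y < x < alpha j -> alpha i < x < alpha j.
    by move=> /andP[yx ->]; rewrite (lt_trans cy).
  have //: false; apply: H => x /[dup] /andP[yx _] /cx cxd; [exact: A0| |exact: hW].
  apply: h0 => //; rewrite mulr_gt0 ?subr_gt0 ?(le_lt_trans ya) //.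
  by rewrite -sgr_gt0 sgA // sgr_gt0.
- have ya : y <= a by move: Aya; rewrite nmulr_rge0 // subr_le0.
  have := @ltr_lame_weight _ alpha rho W h (alpha i) y hrho cy.
  rewrite Wy lame_weight_root // mul0r mulr0 ltxx => H.
  have cx x : alpha i < x < y -> alpha i < x < alpha j.
    by move=> /andP[-> xy]; rewrite (lt_trans xy).
  have //: false; apply: H => x /[dup] /andP[_ xy] /cx cxd; [exact: A0| |exact: hW].
  apply: h0 => //; rewrite nmulr_rgt0 ?subr_lt0 ?(lt_le_trans xy) //.
  by rewrite -sgr_lt0 sgA // sgr_lt0.
Qed.

(** End points for the comparison argument: there [lame_weight * W] has a known
   sign, [W] being the Wronskian-like combination of [critical_points_gap]. *)
Definition gap_end (R : realType) (alpha : 'I_3 -> R) (a : R) (phi : {poly R})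
    (y : R) : Prop :=
  (exists j, y = alpha j) \/
  (phi^`().[y] = 0 /\ (lame_A alpha).[y] * (y - a) < 0).

Lemma gap_endZ (R : realType) (alpha : 'I_3 -> R) (a : R) phi y s :
  gap_end alpha a phi y -> gap_end alpha a (s *: phi) y.
Proof.
move=> [?|[d ?]]; [by left|right; split=> //].
by rewrite derivZ hornerZ d mulr0.
Qed.

(** The terms in [x - a] cancel in the equation satisfied by
   [W], so its right-hand side has a sign as soon as [phi1^`()] and [phi2^`()]
   have one; the sign of [phi1] at a critical point is read off the equation. *)
Lemma critical_points_gap (R : realType) (alpha rho : 'I_3 -> R) mu1 mu2 a
    phi1 phi2 c d :
  (forall j, 0 < rho j) -> 0 < mu1 -> mu1 < mu2 ->
  lame_solution alpha rho mu1 a phi1 -> lame_solution alpha rho mu2 a phi2 ->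
  c < d -> (forall x, c < x < d -> (lame_A alpha).[x] != 0) ->
  (forall x, c < x < d -> ~~ root phi1^`() x) ->
  gap_end alpha a phi1 c -> gap_end alpha a phi1 d ->
  exists2 x, c < x < d & root phi2^`() x.
Proof.
move=> hrho mu1_0 mu12 E1 E2 cd A0 nr1 ec ed.
have mu2_0 : 0 < mu2 by apply: lt_trans mu12.
apply: contrapT => nr2.
have {}nr2 x : c < x < d -> ~~ root phi2^`() x.
  by move=> cxd; apply/negP => rx; apply: nr2; exists x.
have [s1 _ p1] := noroot_sign cd nr1.
have [s2 _ p2] := noroot_sign cd nr2.
move: p1 p2 (lame_solutionZ s1 E1) (lame_solutionZ s2 E2).
move: (gap_endZ s1 ec) (gap_endZ s1 ed).
rewrite -!derivZ; move: (s1 *: phi1) (s2 *: phi2).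
move=> {nr1 nr2 s1 s2 ec ed E1 E2 phi1 phi2} phi1 phi2 ec ed p1 p2 E1 E2.
pose W := mu1^-1 *: (phi1^`() * phi2) - mu2^-1 *: (phi1 * phi2^`()).
have key := @ltr_lame_weight _ alpha rho W
  (fun x => (mu1^-1 - mu2^-1) * (phi1^`().[x] * phi2^`().[x])) c d hrho cd A0.
have ltmu : 0 < mu1^-1 - mu2^-1.
  by rewrite subr_gt0 ltf_pV2 ?posrE.
have Wc : 0 <= lame_weight alpha rho c * W.[c].
  case: ec => [[j ->]|[dc Ac]]; first by rewrite lame_weight_root ?mul0r.
  apply: mulr_ge0; first exact: lame_weight_ge0.
  have d2 := horner_ge0_left cd p2.
  have := lame_solution_horner c E1; have := deriv_ge0_left cd dc p1.
  rewrite /W !(hornerD, hornerN, hornerM, hornerZ) dc => dd.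
  rewrite mulr0 addr0 mul0r mulr0 sub0r => Ec.
  have p1c : phi1.[c] <= 0.
    have : 0 <= (lame_A alpha).[c] * ((lame_A alpha).[c] * phi1^`()^`().[c]).
      by rewrite mulrA -expr2 mulr_ge0 ?sqr_ge0.
    rewrite Ec.
    have -> : (lame_A alpha).[c] * (mu1 * ((c - a) * phi1.[c])) =
      mu1 * ((lame_A alpha).[c] * (c - a) * phi1.[c]) by ring.
    by rewrite pmulr_rge0 // nmulr_rge0.
  rewrite oppr_ge0 mulr_ge0_le0 ?mulr_le0_ge0 //.
  by rewrite invr_ge0 ltW.
have Wd : lame_weight alpha rho d * W.[d] <= 0.
  case: ed => [[j ->]|[dc Ac]]; first by rewrite lame_weight_root ?mul0r.
  apply: mulr_ge0_le0; first exact: lame_weight_ge0.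
  have d2 := horner_ge0_right cd p2.
  have := lame_solution_horner d E1; have := deriv_le0_right cd dc p1.
  rewrite /W !(hornerD, hornerN, hornerM, hornerZ) dc => dd.
  rewrite mulr0 addr0 mul0r mulr0 sub0r => Ec.
  have p1c : 0 <= phi1.[d].
    have : (lame_A alpha).[d] * ((lame_A alpha).[d] * phi1^`()^`().[d]) <= 0.
      by rewrite mulrA -expr2 mulr_ge0_le0 ?sqr_ge0.
    rewrite Ec.
    have -> : (lame_A alpha).[d] * (mu1 * ((d - a) * phi1.[d])) =
      mu1 * ((lame_A alpha).[d] * (d - a) * phi1.[d]) by ring.
    by rewrite pmulr_rle0 // nmulr_rle0.
  by rewrite oppr_le0 !mulr_ge0 // invr_ge0 ltW.
have : lame_weight alpha rho c * W.[c] < lame_weight alpha rho d * W.[d].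
  apply: key => x cxd; first by rewrite !mulr_gt0 ?p1 ?p2.
  have F1 := lame_solution_horner x E1; have F2 := lame_solution_horner x E2.
  rewrite /W derivB !derivZ !derivM !(hornerD, hornerN, hornerM, hornerZ).
  transitivity (mu1^-1 * phi2.[x] * ((lame_A alpha).[x] * phi1^`()^`().[x] +
      (lame_B alpha rho).[x] * phi1^`().[x]) - mu2^-1 * phi1.[x] *
      ((lame_A alpha).[x] * phi2^`()^`().[x] +
      (lame_B alpha rho).[x] * phi2^`().[x]) +
      (lame_A alpha).[x] * ((mu1^-1 - mu2^-1) * (phi1^`().[x] * phi2^`().[x]))).
    by ring.
  by rewrite F1 F2; field; rewrite !gt_eqF.
by move=> /(le_lt_trans Wc) /lt_le_trans /(_ Wd); rewrite ltxx.
Qed.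

Lemma size_critical_points_lt (R : realType) (alpha rho : 'I_3 -> R) mu1 mu2 a
    phi1 phi2 (i j : 'I_3) :
  (forall j, 0 < rho j) -> 0 < mu1 -> mu1 < mu2 ->
  lame_solution alpha rho mu1 a phi1 -> lame_solution alpha rho mu2 a phi2 ->
  phi1^`() != 0 -> phi2^`() != 0 -> alpha i < alpha j ->
  (forall x, alpha i < x < alpha j -> (lame_A alpha).[x] != 0) ->
  (size (roots phi1^`() (alpha i) (alpha j)) <
   size (roots phi2^`() (alpha i) (alpha j)))%N.
Proof.
move=> hrho mu1_0 mu12 E1 E2 d1 d2 ij A0.
set c := alpha i in A0 ij *; set d := alpha j in A0 ij *.
(* Critical points of [phi1] are met one after the other from the left: [y] is
   the last one met, or [c], and [s] lists those that remain. *)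
have gen : forall s y, c <= y -> y < d -> gap_end alpha a phi1 y ->
    path <%R y s -> {subset s <= roots phi1^`() c d} ->
    (forall z, y < z < d -> root phi1^`() z -> z \in s) ->
    (size s < size (roots phi2^`() y d))%N.
  elim=> [|z s IH] y cy yd ey /=.
    move=> _ _ nr.
    have [|||x xin rx] :=
      critical_points_gap hrho mu1_0 mu12 E1 E2 yd _ _ ey.
    - by move=> x /andP[yx xd]; rewrite A0 // xd (le_lt_trans cy).
    - by move=> x yxd; apply/negP => /(nr _ yxd).
    - by left; exists j.
    rewrite lt0n size_eq0.
    by apply: contraPneq (root_in_roots d2 (xin : x \in `]y, d[) rx) => ->.
  move=> /andP[yz pzs] sub nr.
  have zin : z \in roots phi1^`() c d by apply: sub; rewrite mem_head.
  have := roots_in zin; rewrite in_itv /= => czd; have [cz zd] := andP czd.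
  have rz : phi1^`().[z] = 0 by apply/eqP; exact: root_roots zin.
  have ez : gap_end alpha a phi1 z.
    by right; split=> //; apply: (critical_point_oscillatory hrho E1 mu1_0 d1 A0).
  have lts : forall w, w \in s -> z < w.
    by move=> w; move: w; apply/allP; apply: order_path_min pzs; apply: lt_trans.
  have [||x xin rx] := critical_points_gap hrho mu1_0 mu12 E1 E2 yz _ _ ey ez.
  - by move=> x /andP[yx xz]; rewrite A0 // (lt_trans xz) // (le_lt_trans cy).
  - move=> x /andP[yx xz]; apply/negP => rx.
    have := nr x; rewrite yx (lt_trans xz) // => /(_ isT rx).
    rewrite inE => /orP[/eqP xE|/lts]; first by rewrite xE ltxx in xz.
    by rewrite ltNge ltW.
  have {}IH : (size s < size (roots phi2^`() z d))%N.
    apply: IH => //; first exact: ltW.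
      by move=> w ws; apply: sub; rewrite inE ws orbT.
    move=> w /andP[zw wd] rw.
    have := nr w; rewrite (lt_trans yz) // wd => /(_ isT rw).
    by rewrite inE => /orP[/eqP wE|//]; rewrite wE ltxx in zw.
  apply: leq_ltn_trans IH _.
  have [yx xz] := andP xin.
  have -> : (size (roots phi2^`() z d)).+1 = size (x :: roots phi2^`() z d) by [].
  apply: uniq_leq_size => [|w].
    rewrite /= uniq_roots andbT; apply/negP => /roots_in.
    by rewrite in_itv /= => /andP[zx _]; rewrite ltNge (ltW xz) in zx.
  rewrite inE => /orP[/eqP ->|wz].
    by apply: root_in_roots => //; rewrite in_itv /= yx (lt_trans xz).
  apply: root_in_roots (root_roots wz) => //.
  by move: (roots_in wz); rewrite !in_itv /= => /andP[zw ->]; rewrite (lt_trans yz).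
apply: gen => //; first by left; exists i.
- exact: path_roots.
- by move=> z cz rz; apply: root_in_roots.
Qed.

(** * No number is a Van Vleck zero of all large orders *)

(** The number of critical points in each of the two gaps between singular
   points grows with [k] by at least one at every step; their total number is
   at most [k - 1], which is too small for that. *)
Lemma no_common_van_vleck_zero (R : realType) (alpha rho : 'I_3 -> R) (a : R)
    (K : nat) (mu : nat -> R) (phi : nat -> {poly R}) :
  (forall i j : 'I_3, (i < j)%N -> alpha i < alpha j) ->
  (forall j, 0 < rho j) -> (0 < K)%N ->
  (forall k, (K <= k)%N -> 0 < mu k < mu k.+1) ->
  (forall k, (K <= k)%N -> size (phi k) = k.+1) ->
  (forall k, (K <= k)%N -> lame_solution alpha rho (mu k) a (phi k)) ->
  False.
Proof.
move=> halpha hrho K0 hmu hsize hsol.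
pose i0 : 'I_3 := ord0; pose i1 : 'I_3 := lift ord0 ord0.
pose i2 : 'I_3 := lift ord0 (lift ord0 ord0).
have a01 : alpha i0 < alpha i1 by apply: halpha.
have a12 : alpha i1 < alpha i2 by apply: halpha.
have sized k : (K <= k)%N -> size (phi k)^`() = k.
  by move=> Kk; rewrite size_deriv hsize.
have dphi k : (K <= k)%N -> (phi k)^`() != 0.
  by move=> Kk; rewrite -size_poly_gt0 sized // (leq_trans K0).
have grow (i j : 'I_3) : alpha i < alpha j ->
    (forall x, alpha i < x < alpha j -> (lame_A alpha).[x] != 0) ->
    forall t, (t <= size (roots (phi (K + t))^`() (alpha i) (alpha j)))%N.
  move=> ij A0; elim=> [//|t IH]; apply: leq_ltn_trans IH _.
  have Kt : (K <= K + t)%N by rewrite leq_addr.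
  have [m0 m1] := andP (hmu _ Kt).
  rewrite addnS; apply: (size_critical_points_lt hrho m0 m1) => //.
  - exact: hsol.
  - by apply: hsol; rewrite ltnW.
  - exact: dphi.
  - by apply: dphi; rewrite ltnW.
have n01 x : alpha i0 < x < alpha i1 -> (lame_A alpha).[x] != 0.
  move=> /andP[x0 x1]; rewrite lame_AE !hornerE !mulf_neq0 //= subr_eq0.
  - by rewrite gt_eqF.
  - by rewrite lt_eqF.
  - by rewrite lt_eqF // (lt_trans x1).
have n12 x : alpha i1 < x < alpha i2 -> (lame_A alpha).[x] != 0.
  move=> /andP[x1 x2]; rewrite lame_AE !hornerE !mulf_neq0 //= subr_eq0.
  - by rewrite gt_eqF // (lt_trans a01).
  - by rewrite gt_eqF.
  - by rewrite lt_eqF.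
have r1 := grow _ _ a01 n01 K; have r2 := grow _ _ a12 n12 K.
have KK : (K <= K + K)%N by rewrite leq_addr.
set p := (phi (K + K)%N)^`() in r1 r2.
have := @max_poly_roots _ p
  (roots p (alpha i0) (alpha i1) ++ roots p (alpha i1) (alpha i2)).
rewrite dphi // size_cat sized //; move=> /(_ isT) H.
have : (size (roots p (alpha i0) (alpha i1)) +
    size (roots p (alpha i1) (alpha i2)) < K + K)%N.
  apply: H.
    by rewrite all_cat; apply/andP; split; apply/allP => x; apply: root_roots.
  rewrite cat_uniq !uniq_roots andbT /=; apply/hasPn => x.
  move=> /roots_in; rewrite in_itv /= => /andP[x1 _]; apply/negP => /roots_in.
  by rewrite in_itv /= => /andP[_ /(lt_trans x1)]; rewrite ltxx.
by rewrite ltnNge leq_add.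
Qed.

(** * Coefficients of the Lame equation *)

Lemma coef_lame_operator (F : comNzRingType) (a2 a1 a0 s b1 b0 : F)
    (p : {poly F}) j :
  let A := 'X^3 + a2 *: 'X^2 + a1 *: 'X + a0%:P in
  let B := s *: 'X^2 + b1 *: 'X + b0%:P in
  (A * p^`()^`() + B * p^`())`_j.+1 =
    j%:R * (j%:R - 1 + s) * p`_j + (j%:R + 1) * (j%:R * a2 + b1) * p`_j.+1 +
    (j%:R + 2) * ((j%:R + 1) * a1 + b0) * p`_j.+2 +
    (j%:R + 3) * (j%:R + 2) * a0 * p`_j.+3.
Proof.
have cd (q : {poly F}) i : q^`()`_i = i.+1%:R * q`_i.+1.
  by rewrite coef_deriv mulr_natl.
move=> A B; set RHS := (X in _ = X).
rewrite /A /B !mulrDl -!scalerAl !coefD !coefZ !coefXnM !coefXM.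
rewrite !coefCM !cd {}/RHS.
case: j => [|[|j]]; rewrite ?subSS ?subn0 /=; ring.
Qed.

Lemma coef0_lame_operator (F : comNzRingType) (a2 a1 a0 s b1 b0 : F)
    (p : {poly F}) :
  let A := 'X^3 + a2 *: 'X^2 + a1 *: 'X + a0%:P in
  let B := s *: 'X^2 + b1 *: 'X + b0%:P in
  (A * p^`()^`() + B * p^`())`_0 = b0 * p`_1 + 2 * a0 * p`_2.
Proof.
have cd (q : {poly F}) i : q^`()`_i = i.+1%:R * q`_i.+1.
  by rewrite coef_deriv mulr_natl.
move=> A B; rewrite /A /B !mulrDl -!scalerAl !coefD !coefZ !coefXnM !coefXM.
rewrite !coefCM !cd /=. rewrite ?sub0n; ring.
Qed.

(** The constant forced on a solution of degree [j] by the leading coefficients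
   of the Lame equation, [sg] being the leading coefficient of [lame_B]. *)
Definition lame_eigenvalue (R : nzRingType) (sg : R) (j : nat) : R :=
  j%:R * (j%:R - 1 + sg).

Section Cubic.
Variables (R : realType) (alpha rho : 'I_3 -> R).
Let x0 := alpha ord0.
Let x1 := alpha (lift ord0 ord0).
Let x2 := alpha (lift ord0 (lift ord0 ord0)).
Let r0 := rho ord0.
Let r1 := rho (lift ord0 ord0).
Let r2 := rho (lift ord0 (lift ord0 ord0)).

Lemma lame_A_cubic : lame_A alpha =
  'X^3 + (- (x0 + x1 + x2)) *: 'X^2 + (x0 * x1 + x0 * x2 + x1 * x2) *: 'X +
  (- (x0 * x1 * x2))%:P.
Proof.
rewrite lame_AE -!mul_polyC !(polyCN, polyCD, polyCM) -/x0 -/x1 -/x2; ring.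
Qed.

Lemma lame_B_quadratic : lame_B alpha rho =
  (\sum_(j < 3) 2 * rho j) *: 'X^2 +
  (- (2 * r0 * (x1 + x2) + 2 * r1 * (x0 + x2) + 2 * r2 * (x0 + x1))) *: 'X +
  (2 * r0 * (x1 * x2) + 2 * r1 * (x0 * x2) + 2 * r2 * (x0 * x1))%:P.
Proof.
rewrite lame_BE !big_ord_recl big_ord0 addr0 -!mul_polyC.
rewrite !(polyCN, polyCD, polyCM) -/x0 -/x1 -/x2 -/r0 -/r1 -/r2; ring.
Qed.

End Cubic.

(** At a real Van Vleck zero the solution may be taken real and monic: the
   leading coefficients force [mu] to be real, so the real part of a monic
   solution is again a solution of the same degree. *)
Lemma van_vleck_zero_real (R : realType) (alpha rho : 'I_3 -> R) k (nu : R) :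
  van_vleck_zero alpha rho k (real_complex R nu) ->
  exists phi : {poly R},
    [/\ phi \is monic, size phi = k.+1 &
        lame_solution alpha rho
          (lame_eigenvalue (\sum_(j < 3) 2 * rho j) k) nu phi].
Proof.
move=> [mu [phi [sz]]].
pose toC := real_complex R.
rewrite /lame_solution /lame_eigenvalue.
have [a2 [a1 [a0 ->]]] : exists a2 a1 a0 : R,
    lame_A alpha = 'X^3 + a2 *: 'X^2 + a1 *: 'X + a0%:P.
  by do 3 eexists; exact: lame_A_cubic.
set s := \sum_(j < 3) _.
have [b1 [b0 ->]] : exists b1 b0 : R,
    lame_B alpha rho = s *: 'X^2 + b1 *: 'X + b0%:P.
  by do 2 eexists; exact: lame_B_quadratic.
rewrite -/toC => E.
have mapA : map_poly toC ('X^3 + a2 *: 'X^2 + a1 *: 'X + a0%:P) =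
    'X^3 + toC a2 *: 'X^2 + toC a1 *: 'X + (toC a0)%:P.
  by rewrite !rmorphD /= !map_polyZ /= !map_polyXn map_polyX map_polyC.
have mapB : map_poly toC (s *: 'X^2 + b1 *: 'X + b0%:P) =
    toC s *: 'X^2 + toC b1 *: 'X + (toC b0)%:P.
  by rewrite !rmorphD /= !map_polyZ /= !map_polyXn map_polyX map_polyC.
rewrite {}mapA {}mapB in E.
rewrite -[phi^`(2)]/(phi^`()^`()) in E.
have c0 : phi`_k != 0.
  by rewrite -[k]/(k.+1.-1) -sz -lead_coefE lead_coef_eq0 -size_poly_gt0 sz.
have phi0 j : (k < j)%N -> phi`_j = 0.
  by move=> kj; rewrite nth_default // sz.
have coefR : ('X - (toC nu)%:P : {poly R[i]}) * phi = 'X * phi - toC nu *: phi.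
  by rewrite mulrBl mul_polyC.
have muE : mu = toC (k%:R * (k%:R - 1 + s)).
  have /(congr1 (fun p : {poly R[i]} => p`_k.+1)) := E.
  rewrite coef_lame_operator coefR coefZ coefB coefXM coefZ /=.
  have [-> -> ->] : [/\ phi`_k.+1 = 0, phi`_k.+2 = 0 & phi`_k.+3 = 0].
    by split; apply: phi0; lia.
  rewrite !mulr0 !addr0 subr0 => /(mulIf c0) <-.
  by rewrite /toC rmorphM rmorphD rmorphB /= rmorph1 !rmorph_nat.
pose psi := (phi`_k)^-1 *: phi.
pose r : {poly R} := \poly_(i < k.+1) complex.Re psi`_i.
have rE i : r`_i = complex.Re psi`_i.
  by rewrite coef_poly ltnS; case: leqP => // ki; rewrite coefZ (phi0 i ki) mulr0.
have rk : r`_k = 1 by rewrite rE coefZ mulVf.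
have szr : size r = k.+1.
  apply/eqP; rewrite eqn_leq size_poly /= ltnNge; apply/negP => szr.
  by move: rk; rewrite nth_default // => /eqP; rewrite eq_sym oner_eq0.
exists r; split=> //; first by rewrite monicE lead_coefE szr /= rk.
rewrite -[r^`(2)]/(r^`()^`()).
have Epsi : ('X^3 + toC a2 *: 'X^2 + toC a1 *: 'X + (toC a0)%:P) * psi^`()^`() +
     (toC s *: 'X^2 + toC b1 *: 'X + (toC b0)%:P) * psi^`() =
     mu *: ('X * psi - toC nu *: psi).
  rewrite /psi !derivZ -!scalerAr -scalerDr E coefR.
  by rewrite scalerA mulrC -scalerA scalerBr !scalerA [_ * toC nu]mulrC.
have ReM (x : R) (z : R[i]) : complex.Re (toC x * z) = x * complex.Re z.
  by case: z => u v /=; rewrite mul0r subr0.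
have ReD (z w : R[i]) : complex.Re (z + w) = complex.Re z + complex.Re w.
  by case: z w => [? ?] [? ?].
have ReN (z : R[i]) : complex.Re (- z) = - complex.Re z by case: z.
have natC n : (n%:R : R[i]) = toC n%:R by rewrite /toC rmorph_nat.
have oneC : (1 : R[i]) = toC 1 by rewrite /toC rmorph1.
have addC x y : toC x + toC y = toC (x + y) by rewrite /toC rmorphD.
have mulC x y : toC x * toC y = toC (x * y) by rewrite /toC rmorphM.
have oppC x : - toC x = toC (- x) by rewrite /toC rmorphN.
clearbody r; clearbody psi.
rewrite mulrBl mul_polyC; apply/polyP => -[|j].
  have /(congr1 (fun p : {poly R[i]} => complex.Re p`_0)) := Epsi.
  rewrite !coef0_lame_operator muE !coefZ !coefB !coefXM !coefZ /= !sub0r !rE.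
  by rewrite !natC !mulC !(ReM, ReD, ReN).
have /(congr1 (fun p : {poly R[i]} => complex.Re p`_j.+1)) := Epsi.
rewrite !coef_lame_operator muE !coefZ !coefB !coefXM !coefZ /= !rE.
by rewrite !natC oneC !(oppC, addC, mulC) !(ReM, ReD, ReN).
Qed.

(** * Orthogonality with respect to a positive semidefinite functional *)

Section Orthogonality.
Variables (R : realType) (L : {scalar {poly R}}) (P : nat -> {poly R}).
Hypothesis L_sqr_ge0 : forall q, 0 <= L (q * q).
Hypothesis P_monic : forall k, P k \is monic.
Hypothesis size_P : forall k, size (P k) = k.+2.
Hypothesis L_orth : forall k, (1 <= k)%N ->
  forall q : {poly R}, (size q <= k.+1)%N -> L (P k * q) = 0.

Lemma isotropic_orthogonal (r q : {poly R}) : L (r * r) = 0 -> L (r * q) = 0.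
Proof.
move=> r0; apply/eqP; apply/negPn/negP => rq0.
(* At this [t] the form takes the value [-1] on [t *: r + q]. *)
pose t := - (L (q * q) + 1) / (2 * L (r * q)).
have := L_sqr_ge0 (t *: r + q).
have -> : (t *: r + q) * (t *: r + q) =
    (t ^+ 2) *: (r * r) + ((2 * t) *: (r * q) + q * q).
  by rewrite -!mul_polyC !polyCM; ring.
rewrite !linearD !linearZ /= r0 mulr0 add0r /t.
have -> : 2 * (- (L (q * q) + 1) / (2 * L (r * q))) * L (r * q) + L (q * q) = -1.
  by field.
by rewrite ler0N1.
Qed.

(** If the form [q |-> L (q * q)] is degenerate, an isotropic polynomial [r] of
   least degree divides [P k] for large [k]: the remainder of the division is
   orthogonal to [P k] and to [r], hence isotropic of smaller degree. *)
Lemma degenerate_common_divisor (r0 : {poly R}) : L 1 != 0 ->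
  r0 != 0 -> L (r0 * r0) = 0 ->
  exists r : {poly R}, (1 < size r)%N /\
    forall k, (1 <= k)%N -> (size r <= k)%N -> r %| P k.
Proof.
move=> L1 r0n0 Lr0.
pose isot n := `[< exists r : {poly R}, [/\ r != 0, size r = n & L (r * r) = 0] >].
have [|n /asboolP [r [rn0 szr Lr]] minr] := @ex_minnP isot.
  by exists (size r0); apply/asboolP; exists r0.
exists r; split.
  rewrite ltnNge; apply/negP => /size1_polyC rE.
  move: Lr rn0; rewrite rE polyC_eq0 -polyCM -[(_ * _)%:P]mulr1 mul_polyC linearZ /=.
  by move=> /eqP; rewrite !mulf_eq0 (negPf L1) orbF orbb => ->.
move=> k k1 szk; apply/modp_eq0P/eqP; apply/negPn/negP => t0.
have szt : (size (P k %% r)%R < size r)%N by rewrite ltn_modp.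
have Lt : L ((P k %% r) * (P k %% r)) = 0.
  have tE : P k %% r = P k - P k %/ r * r.
    by rewrite {2}[P k](divp_eq _ r) addrAC subrr add0r.
  rewrite {1}tE mulrBl linearB /= L_orth // ?sub0r; last first.
    by rewrite (leq_trans (ltnW szt)) // (leq_trans szk).
  by rewrite mulrAC mulrC isotropic_orthogonal ?oppr0.
have := minr (size (P k %% r)); rewrite -szr leqNgt szt => H.
by have //: false; apply: H; apply/asboolP; exists (P k %% r).
Qed.

(** With [b] and [c] chosen so as to lower the degree, the difference [t] of the
   two sides is orthogonal to each of its four terms, hence to itself. *)
Lemma three_term_recurrence :
  (forall q, L (q * q) = 0 -> q = 0) -> forall k, (2 <= k)%N ->
  exists b c, P k.+1 = ('X - b%:P) * P k - c *: P k.-1.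
Proof.
move=> Ldef [|[|k]] // _ /=.
have lead n : (P n)`_n.+1 = 1.
  by have /monicP := P_monic n; rewrite lead_coefE size_P.
pose t1 := 'X * P k.+2 - P k.+3.
pose b := t1`_k.+3; pose t2 := t1 - b *: P k.+2.
pose c := t2`_k.+2; pose t := t2 - c *: P k.+1.
have szt : (size t <= k.+2)%N.
  apply/leq_sizeP => j; rewrite leq_eqVlt => /orP[/eqP <-|].
    by rewrite coefB coefZ lead mulr1 subrr.
  rewrite leq_eqVlt => /orP[/eqP <-|].
    rewrite /t coefB coefZ [(P k.+1)`_k.+3]nth_default ?size_P // mulr0 subr0.
    by rewrite coefB coefZ lead mulr1 subrr.
  rewrite leq_eqVlt => /orP[/eqP <-|kj].
    rewrite /t /t2 /t1 !coefB !coefZ coefXM /= !lead subrr.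
    by rewrite ![_`_k.+4]nth_default ?size_P // !mulr0 !subr0.
  rewrite /t /t2 /t1 !coefB !coefZ coefXM.
  by rewrite !nth_default ?size_P ?mulr0 ?subr0 ?if_same //; lia.
exists b, c; suff : t = 0.
  move=> /eqP; rewrite subr_eq0 => /eqP t0.
  by rewrite -t0 /t2 /t1 mulrBl mul_polyC; ring.
apply: Ldef; rewrite {1}/t /t2 /t1 !mulrBl !linearB /= -!scalerAl !linearZ /=.
have Pt n : (k < n)%N -> L (P n * t) = 0.
  by move=> kn; rewrite L_orth //; [case: n kn | apply: leq_trans szt _].
have XPt : L ('X * P k.+2 * t) = 0.
  rewrite mulrAC mulrC L_orth // (leq_trans (size_polyMleq _ _)) // size_polyX.
  by rewrite add2n.
rewrite XPt !Pt; try lia.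
by rewrite /GRing.scale /= oppr0 !mulr0 !addr0.
Qed.

End Orthogonality.

Lemma common_root_of_divisor (R : fieldType) (n : nat) (nu : 'I_n -> R)
    (r : {poly R}) : (1 < size r)%N -> r %| \prod_(i < n) ('X - (nu i)%:P) ->
  exists a, root r a.
Proof.
move=> szr /dvdp_prod_XsubC [m rE].
case: (mask m (index_enum 'I_n)) rE => [|i l] rE.
  by move: szr; rewrite (eqp_size rE) big_nil size_poly1.
by exists (nu i); rewrite (eqp_root rE) big_cons rootM root_XsubC eqxx.
Qed.

(** * Power sums of the roots along a recurrence *)

(** The nominal degree [n] is kept apart from [size p], so that this is linear in
   [p] and applies to the lower order terms of a recurrence as well. *)
Definition top_coef (R : nzRingType) (n : nat) (p : {poly R}) (i : nat) : R :=
  if (i <= n)%N then p`_(n - i) else 0.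

(** Newton's formulas for the sums of the powers of the roots of a monic
   polynomial. *)
Definition power_sum1 (R : nzRingType) n (p : {poly R}) : R := - top_coef n p 1.

Definition power_sum2 (R : nzRingType) n (p : {poly R}) : R :=
  top_coef n p 1 ^+ 2 - 2 * top_coef n p 2.

Definition power_sum4 (R : nzRingType) n (p : {poly R}) : R :=
  top_coef n p 1 ^+ 4 - 4 * (top_coef n p 1 ^+ 2 * top_coef n p 2) +
  2 * top_coef n p 2 ^+ 2 + 4 * (top_coef n p 1 * top_coef n p 3) -
  4 * top_coef n p 4.

Section TopCoef.
Variable R : comNzRingType.
Implicit Types (p q : {poly R}) (n i : nat).

Lemma top_coefB n p q i : top_coef n (p - q) i = top_coef n p i - top_coef n q i.
Proof. by rewrite /top_coef; case: ifP => _; rewrite ?coefB ?subr0. Qed.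

Lemma top_coefZ n a p i : top_coef n (a *: p) i = a * top_coef n p i.
Proof. by rewrite /top_coef; case: ifP => _; rewrite ?coefZ ?mulr0. Qed.

Lemma top_coefX n p i : top_coef n.+1 ('X * p) i = top_coef n p i.
Proof.
rewrite /top_coef coefXM; case: (ltngtP i n.+1) => [|ni|->]; rewrite ?ltnS.
- by move=> le_in; rewrite le_in subn_eq0 ltnNge le_in /= subSn.
- by rewrite leqNgt (ltn_trans _ ni).
- by rewrite subnn ltnn.
Qed.

Lemma top_coefS n p i : top_coef n.+1 p i.+1 = top_coef n p i.
Proof. by []. Qed.

Lemma top_coef_small n p : (size p <= n)%N -> top_coef n p 0 = 0.
Proof. by move=> sp; rewrite /top_coef subn0 nth_default. Qed.

Lemma top_coef0_monic n p : p \is monic -> size p = n.+1 -> top_coef n p 0 = 1.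
Proof. by move=> /monicP <- sp; rewrite /top_coef subn0 lead_coefE sp. Qed.

End TopCoef.

(** A step of a recurrence in which the new polynomial involves the three
   previous ones.  The coefficients vanish where there are not enough previous
   terms, so that the truncated predecessors do no harm. *)
Definition rec_step (R : nzRingType) (G : nat -> {poly R}) (b c f : nat -> R)
    (s : nat) : Prop :=
  [/\ G s.+1 = ('X - (b s)%:P) * G s - c s *: G s.-1 - f s *: G s.-2,
      s = 0%N -> c s = 0 & (s <= 1)%N -> f s = 0].

Section PowerSums.
Variables (R : fieldType) (G : nat -> {poly R}) (b c f : nat -> R).
Hypothesis G_monic : forall s, G s \is monic.
Hypothesis size_G : forall s, size (G s) = s.+1.

Let e s i := top_coef s (G s) i.

Lemma top_coef_rec s : rec_step G b c f s ->
  [/\ e s.+1 1 = e s 1 - b s, e s.+1 2 = e s 2 - b s * e s 1 - c s,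
      e s.+1 3 = e s 3 - b s * e s 2 - c s * e s.-1 1 - f s &
      e s.+1 4 = e s 4 - b s * e s 3 - c s * e s.-1 2 - f s * e s.-2 1].
Proof.
case=> Gs c0 f0.
have e0 t : top_coef t (G t) 0 = 1 by rewrite top_coef0_monic.
have cE i : c s * top_coef s.+1 (G s.-1) i.+2 = c s * e s.-1 i.
  by case: s {Gs f0} c0 => [->|s _] //; rewrite !mul0r.
have fE i : f s * top_coef s.+1 (G s.-2) i.+3 = f s * e s.-2 i.
  by case: s {Gs c0 cE} f0 => [|[|s]] //= f0; rewrite f0 // !mul0r.
have c1 : c s * top_coef s.+1 (G s.-1) 1 = 0.
  case: s {Gs f0 cE fE} c0 => [->|s _] //=; first by rewrite mul0r.
  by rewrite top_coefS top_coef_small ?mulr0 // size_G.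
have f1 : f s * top_coef s.+1 (G s.-2) 1 = 0.
  case: s {Gs c0 cE fE c1} f0 => [|[|s]] f0; try by rewrite f0 // mul0r.
  by rewrite top_coefS top_coef_small ?mulr0 // size_G /=; lia.
have f2 : f s * top_coef s.+1 (G s.-2) 2 = 0.
  case: s {Gs c0 cE fE c1 f1} f0 => [|[|s]] f0; try by rewrite f0 // mul0r.
  by rewrite !top_coefS top_coef_small ?mulr0 // size_G /=; lia.
by split; rewrite /e Gs mulrBl mul_polyC !(top_coefB, top_coefX, top_coefZ)
  ?cE ?fE ?c1 ?f1 ?f2 ?subr0 top_coefS ?e0 ?mulr1 /e ?e0 ?mulr1.
Qed.

Lemma power_sum1_rec s : rec_step G b c f s ->
  power_sum1 s.+1 (G s.+1) - power_sum1 s (G s) = b s.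
Proof.
by move=> /top_coef_rec[e1 _ _ _]; rewrite /power_sum1 -!/(e _ _) e1; ring.
Qed.

Lemma power_sum2_rec s : rec_step G b c f s ->
  power_sum2 s.+1 (G s.+1) - power_sum2 s (G s) = b s ^+ 2 + 2 * c s.
Proof.
move=> /top_coef_rec[e1 e2 _ _].
by rewrite /power_sum2 -!/(e _ _) e1 e2; ring.
Qed.

(** The power sums are traces of powers of the matrix of the recurrence, so
   their increments are polynomials in the last few coefficients. *)
Lemma power_sum4_rec s : rec_step G b c f s ->
  (c s != 0 -> rec_step G b c f s.-1) ->
  (f s != 0 -> rec_step G b c f s.-1 /\ rec_step G b c f s.-2) ->
  power_sum4 s.+1 (G s.+1) - power_sum4 s (G s) =
  b s ^+ 4 + 4 * c s * (b s ^+ 2 + b s * b s.-1 + b s.-1 ^+ 2) +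
  2 * c s ^+ 2 + 4 * c s * c s.-1 + 4 * f s * (b s + b s.-1 + b s.-2).
Proof.
move=> rs rc rf; have [e1 e2 e3 e4] := top_coef_rec rs.
rewrite /power_sum4 -!/(e _ _) e1 e2 e3 e4.
have [_ cs0 fs0] := rs.
have cE : c s != 0 -> e s 1 = e s.-1 1 - b s.-1 /\
    e s 2 = e s.-1 2 - b s.-1 * e s.-1 1 - c s.-1.
  move=> c0; have := rc c0; have s0 : (0 < s)%N.
    by rewrite lt0n; apply: contraNneq c0 => s0; apply/eqP/cs0.
  by move=> /top_coef_rec [E1 E2 _ _]; move: E1 E2; rewrite prednK.
have fE : f s != 0 -> e s 1 = e s.-1 1 - b s.-1 /\ e s.-1 1 = e s.-2 1 - b s.-2.
  move=> f0; have [] := rf f0; have s1 : (1 < s)%N.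
    by rewrite ltnNge; apply: contraNN f0 => s1; apply/eqP/fs0.
  move=> /top_coef_rec [E1 _ _ _] /top_coef_rec [E2 _ _ _]; move: E1 E2.
  by rewrite !prednK // ?ltn_predRL // (ltn_trans _ s1).
have [c0|/cE[ec1 ec2]] := eqVneq (c s) 0;
  have [f0|/fE[ef1 ef2]] := eqVneq (f s) 0.
- by rewrite c0 f0; ring.
- have -> : e s.-2 1 = e s 1 + b s.-1 + b s.-2 by rewrite ef1 ef2; ring.
  by rewrite c0; ring.
- by rewrite f0 ec1 ec2; ring.
- have -> : e s.-2 1 = e s.-1 1 + b s.-2 by rewrite ef2; ring.
  by rewrite ec1 ec2; ring.
Qed.

End PowerSums.

(** * The spectral polynomial from a recurrence *)

Fixpoint rec_poly (R : nzRingType) (b c f : nat -> R) (s : nat) {struct s} :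
    {poly R} :=
  match s with
  | 0 => 1
  | s1.+1 => ('X - (b s1)%:P) * rec_poly b c f s1 -
      match s1 with
      | 0 => 0
      | s2.+1 => c s1 *: rec_poly b c f s2 +
          match s2 with 0 => 0 | s3.+1 => f s1 *: rec_poly b c f s3 end
      end
  end.

Lemma rec_poly_step (R : nzRingType) (b c f : nat -> R) s :
  c 0%N = 0 -> f 0%N = 0 -> f 1%N = 0 ->
  rec_step (rec_poly b c f) b c f s.
Proof.
move=> c0 f0 f1; split; [|by move=> ->|by case: s => [|[|]]].
case: s => [|[|s]].
- by rewrite /= c0 f0 !scale0r !subr0 ?subr0.
- rewrite /= f1 scale0r. by rewrite !subr0 addr0.
transitivity (('X - (b s.+2)%:P) * rec_poly b c f s.+2 -
  (c s.+2 *: rec_poly b c f s.+1 + f s.+2 *: rec_poly b c f s)) => //.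
by rewrite opprD addrA.
Qed.

Lemma rec_poly_monic_size (R : fieldType) (b c f : nat -> R) s :
  rec_poly b c f s \is monic /\ size (rec_poly b c f s) = s.+1.
Proof.
elim/ltn_ind: s => -[|s] IH /=; first by rewrite monic1 size_poly1.
set r := match s with 0 => 0 | _ => _ end.
have szr : (size r <= s)%N.
  rewrite /r; case: s IH {r} => [|s] IH; first by rewrite size_poly0.
  apply: leq_trans (size_polyD _ _) _; rewrite geq_max; apply/andP; split.
    by apply: leq_trans (size_scale_leq _ _) _; rewrite (IH s _).2.
  case: s IH => [|s] IH; first by rewrite size_poly0.
  by apply: leq_trans (size_scale_leq _ _) _; rewrite (IH s _).2 //; lia.
have [m sz] := IH s (leqnn _).
have mX : ('X - (b s)%:P) * rec_poly b c f s \is monic.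
  by rewrite monicMr ?monicXsubC.
have sX : size (('X - (b s)%:P) * rec_poly b c f s) = s.+2.
  by rewrite size_monicM ?monicXsubC ?monic_neq0 // size_XsubC sz.
have lt : (size (- r) < size (('X - (b s)%:P) * rec_poly b c f s)%R)%N.
  by rewrite sX size_polyN; lia.
split; last by rewrite size_polyDl.
by rewrite monicE lead_coefDl //; apply/monicP: mX.
Qed.

Section LameRecurrence.
Variables (R : realFieldType) (p q sg b1 b0 : R).

Let mu := lame_eigenvalue sg.

Definition lame_rec_b (k j : nat) : R := - (j%:R * b1 / mu k).

Definition lame_rec_c (k j : nat) : R :=
  - ((j%:R + 1) * (j%:R * p + b0) * (mu k - mu j) / mu k ^+ 2).

Definition lame_rec_f (k j : nat) : R :=
  - ((j%:R + 2) * (j%:R + 1) * q * (mu k - mu j) * (mu k - mu j.+1) / mu k ^+ 3).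

(** Computing the coefficients of a solution [phi] of degree [k] from the top
   expresses the coefficient of ['X^(k - s)], up to a constant, as the value
   at [a] of this polynomial of degree [s]; the last of the linear equations
   then says that [a] is a root of the polynomial of degree [k + 1]. *)
Definition lame_rec_poly (k : nat) : nat -> {poly R} :=
  rec_poly (fun s => lame_rec_b k (k - s)) (fun s => lame_rec_c k (k - s))
    (fun s => lame_rec_f k (k - s)).

Lemma lame_rec_poly_step k s : (1 <= k)%N ->
  rec_step (lame_rec_poly k) (fun s => lame_rec_b k (k - s))
    (fun s => lame_rec_c k (k - s)) (fun s => lame_rec_f k (k - s)) s.
Proof.
move=> k1; apply: rec_poly_step; rewrite ?subn0 ?subn1.
- by rewrite /lame_rec_c subrr !(mulr0, mul0r) oppr0.
- by rewrite /lame_rec_f subrr !(mulr0, mul0r) oppr0.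
- by rewrite /lame_rec_f prednK // subrr !(mulr0, mul0r) oppr0.
Qed.

Lemma lame_rec_poly_root (k : nat) (a : R) (phi : {poly R}) :
  (1 <= k)%N -> mu k != 0 -> phi \is monic -> size phi = k.+1 ->
  ('X^3 + 0 *: 'X^2 + p *: 'X + q%:P) * phi^`()^`() +
    (sg *: 'X^2 + b1 *: 'X + b0%:P) * phi^`() =
    mu k *: (('X - a%:P) * phi) ->
  root (lame_rec_poly k k.+1) a.
Proof.
move=> k1 mu0 phi_monic sz E.
pose w s := \prod_(i < s) (1 - mu (k - i.+1) / mu k).
have wS s : w s.+1 = w s * (1 - mu (k - s.+1) / mu k) by rewrite /w big_ord_recr.
(* [eqS] and [eq0] are the equations for the coefficients of ['X^(j + 1)] and
   of [1]; [w] absorbs the denominators met on the way down from the top. *)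
pose rhs j := (mu k * a + j%:R * b1) * phi`_j +
  (j%:R + 1) * (j%:R * p + b0) * phi`_j.+1 +
  (j%:R + 2) * (j%:R + 1) * q * phi`_j.+2.
have eqS j : (mu k - mu j) * phi`_j = rhs j.+1.
  have /(congr1 (fun r : {poly R} => r`_j.+1)) := E.
  rewrite coef_lame_operator mulrBl mul_polyC coefZ coefB coefXM coefZ /=.
  rewrite /rhs -[j.+1%:R]natr1 => E'; rewrite mulrBl.
  have -> : mu k * phi`_j =
      mu k * (phi`_j - a * phi`_j.+1) + mu k * (a * phi`_j.+1) by ring.
  by rewrite -E' /mu /lame_eigenvalue; ring.
have eq0 : rhs 0%N = 0.
  have /(congr1 (fun r : {poly R} => r`_0)) := E.
  rewrite coef0_lame_operator mulrBl mul_polyC coefZ coefB coefXM coefZ /= => E'.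
  have -> : rhs 0%N = b0 * phi`_1 + 2 * q * phi`_2 - mu k * (0 - a * phi`_0).
    by rewrite /rhs; ring.
  by rewrite E' subrr.
pose val s := (lame_rec_poly k s).[a] = phi`_(k - s) * w s.
have step s : (s <= k)%N -> val s -> val s.-1 -> val s.-2 ->
    mu k * (lame_rec_poly k s.+1).[a] = w s * rhs (k - s)%N.
  move=> sk v1 v2 v3; have [-> _ _] := lame_rec_poly_step s k1.
  rewrite !(hornerD, hornerN, hornerM, hornerZ, hornerX, hornerC) v1 v2 v3.
  have -> : lame_rec_c k (k - s) * (phi`_(k - s.-1) * w s.-1) =
      - ((k - s)%:R + 1) * ((k - s)%:R * p + b0) / mu k * phi`_(k - s).+1 * w s.
    case: s sk {v1 v2 v3} => [|s] sk.
      rewrite subn0 /lame_rec_c subrr !(mulr0, mul0r) oppr0 mul0r.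
      by rewrite [phi`_k.+1]nth_default ?sz // mulr0 mul0r.
    rewrite wS /= -[(k - s)%N]prednK ?subn_gt0 // -subnS /lame_rec_c.
    by field.
  have -> : lame_rec_f k (k - s) * (phi`_(k - s.-2) * w s.-2) =
      - ((k - s)%:R + 2) * ((k - s)%:R + 1) * q / mu k * phi`_(k - s).+2 * w s.
    case: s sk {v1 v2 v3} => [|[|s]] sk.
    - rewrite subn0 /lame_rec_f subrr !(mulr0, mul0r) oppr0 mul0r.
      by rewrite [phi`_k.+2]nth_default ?sz // mulr0 mul0r.
    - rewrite subn1 prednK // /lame_rec_f prednK // subrr.
      rewrite !(mulr0, mul0r) oppr0 mul0r.
      by rewrite [phi`_k.+1]nth_default ?sz // mulr0 mul0r.
    rewrite !wS /=.
    have e1 : (k - s)%N = (k - s.+2).+2 by lia.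
    have e2 : (k - s.+1)%N = (k - s.+2).+1 by lia.
    rewrite e1 e2 /lame_rec_f.
    by field.
  by rewrite /lame_rec_b /rhs; field.
have vals s : (s <= k)%N -> [/\ val s, val s.-1 & val s.-2].
  have v0 : val 0%N.
    rewrite /val subn0 /w big_ord0 mulr1 hornerC.
    by have /monicP := phi_monic; rewrite lead_coefE sz.
  elim: s => [//|s IH] sk; have [v1 v2 v3] := IH (ltnW sk).
  split=> //; apply: (mulfI mu0); rewrite step // ?(ltnW sk) //.
  have e1 : (k - s)%N = (k - s.+1).+1 by lia.
  by rewrite e1 -eqS wS; field.
have [v1 v2 v3] := vals k (leqnn k).
apply/eqP/(mulfI mu0); rewrite step // subnn eq0; ring.
Qed.

End LameRecurrence.

Lemma lame_A_shift (R : realType) (alpha : 'I_3 -> R) m :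
  lame_A alpha \Po ('X + m%:P) = lame_A (fun j => alpha j - m).
Proof.
rewrite !lame_AE !(comp_polyM, comp_polyB, comp_polyX, comp_polyC) !polyCB.
by ring.
Qed.

Lemma lame_B_shift (R : realType) (alpha rho : 'I_3 -> R) m :
  lame_B alpha rho \Po ('X + m%:P) = lame_B (fun j => alpha j - m) rho.
Proof.
rewrite !lame_BE.
rewrite !(comp_polyB, comp_polyD, comp_polyZ, comp_polyM).
rewrite !(comp_polyX, comp_polyC).
by rewrite -!mul_polyC !polyCB; ring.
Qed.

Lemma lame_solution_shift (R : realType) (alpha rho : 'I_3 -> R) mu a phi m :
  lame_solution alpha rho mu a phi ->
  lame_solution (fun j => alpha j - m) rho mu (a - m) (phi \Po ('X + m%:P)).
Proof.
rewrite /lame_solution => E.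
have der p : (p \Po ('X + m%:P))^`() = p^`() \Po ('X + m%:P).
  by rewrite deriv_comp derivD derivX derivC addr0 mulr1.
rewrite -lame_A_shift -lame_B_shift.
have -> : 'X - (a - m)%:P = ('X - a%:P) \Po ('X + m%:P).
  by rewrite comp_polyB comp_polyX comp_polyC polyCB opprB addrA.
rewrite -[(_ \Po _)^`(2)]/((_ \Po _)^`()^`()) !der -!comp_polyM -comp_polyD.
by rewrite -comp_polyZ -E.
Qed.

Lemma spectral_poly_monic (R : realType) k (nu : 'I_k.+1 -> R) :
  spectral_poly nu \is monic.
Proof. exact: monic_prod_XsubC. Qed.

Lemma size_spectral_poly (R : realType) k (nu : 'I_k.+1 -> R) :
  size (spectral_poly nu) = k.+2.
Proof.
by rewrite /spectral_poly size_prod_XsubC /index_enum -enumT size_enum_ord.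
Qed.

(** The [k + 1] Van Vleck zeros are roots of a monic polynomial of degree
   [k + 1], which is therefore the spectral polynomial. *)
Lemma spectral_poly_lame_rec (R : realType) (alpha rho : 'I_3 -> R)
    (k : nat) (nu : 'I_k.+1 -> R) m p q b1 b0 :
  let sg := \sum_(j < 3) 2 * rho j in
  (1 <= k)%N -> 0 < sg -> van_vleck_zeros alpha rho nu ->
  lame_A (fun j => alpha j - m) = 'X^3 + 0 *: 'X^2 + p *: 'X + q%:P ->
  lame_B (fun j => alpha j - m) rho = sg *: 'X^2 + b1 *: 'X + b0%:P ->
  spectral_poly nu \Po ('X + m%:P) = lame_rec_poly p q sg b1 b0 k k.+1.
Proof.
move=> sg k1 sg0 [inj_nu hnu] EA EB.
set G := lame_rec_poly _ _ _ _ _ _ _.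
have [monG szG] : G \is monic /\ size G = k.+2 by apply: rec_poly_monic_size.
pose rs := [seq nu i - m | i : 'I_k.+1].
have mu0 : lame_eigenvalue sg k != 0.
  have k1R : 1 <= k%:R :> R by rewrite ler1n.
  by rewrite /lame_eigenvalue mulf_neq0 // lt0r_neq0 //; move: k1R sg0; lra.
have rootG : all (root G) rs.
  apply/allP => _ /mapP[i _ ->].
  have [phi [mphi sphi /(lame_solution_shift m) E]] :=
    van_vleck_zero_real (proj2 (hnu _) (ex_intro _ i erefl)).
  have sX : size ('X + m%:P : {poly R}) = 2%N by rewrite size_XaddC.
  apply: (@lame_rec_poly_root _ p q sg b1 b0 k _ (phi \Po ('X + m%:P))) => //.
  - rewrite monicE lead_coef_comp ?sX // (monicP mphi) lead_coefXaddC.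
    by rewrite expr1n mulr1.
  - by rewrite size_comp_poly2.
  by move: E; rewrite /lame_solution EA EB.
have uniq_rs : uniq rs.
  rewrite map_inj_uniq ?index_enum_uniq ?enum_uniq // => i j /addIr.
  exact: inj_nu.
have := all_roots_prod_XsubC _ rootG.
rewrite szG size_map size_enum_ord uniq_rootsE => /(_ erefl uniq_rs).
rewrite (monicP monG) scale1r => ->.
rewrite /spectral_poly (big_morph (comp_poly ('X + m%:P))
  (fun a b => comp_polyM a b _) (comp_polyC 1 _)).
rewrite big_map -big_enum /=; apply: eq_bigr => i _.
by rewrite comp_polyB comp_polyX comp_polyC polyCB opprB addrA.
Qed.

(** * Bounded and small families *)

Section Asymptotics.
Variable R : realType.
Implicit Types (u v : nat -> nat -> R).

(** Families indexed by [j <= k], uniformly bounded, respectively [O(1/k)];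
   a sequence is a family that does not depend on [j]. *)
Definition bounded_family u : Prop :=
  exists K : R, forall k j, (2 <= k)%N -> (j <= k)%N -> `|u k j| <= K.

Definition small_family u : Prop := bounded_family (fun k j => k%:R * u k j).

Definition close_families u v : Prop := small_family (fun k j => u k j - v k j).

Lemma bounded_eq u v :
  (forall k j, (2 <= k)%N -> (j <= k)%N -> u k j = v k j) ->
  bounded_family v -> bounded_family u.
Proof. by move=> uv [K hK]; exists K => k j k2 jk; rewrite uv // hK. Qed.

Lemma bounded_family_cst c : bounded_family (fun _ _ => c).
Proof. by exists `|c|. Qed.

Lemma boundedD u v : bounded_family u -> bounded_family v ->
  bounded_family (fun k j => u k j + v k j).
Proof.
move=> [K hK] [M hM]; exists (K + M) => k j k2 jk.
by apply: le_trans (ler_normD _ _) _; rewrite lerD ?hK ?hM.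
Qed.

Lemma boundedN u : bounded_family u -> bounded_family (fun k j => - u k j).
Proof. by move=> [K hK]; exists K => k j k2 jk; rewrite normrN hK. Qed.

Lemma boundedM u v : bounded_family u -> bounded_family v ->
  bounded_family (fun k j => u k j * v k j).
Proof.
move=> [K hK] [M hM]; exists (K * M) => k j k2 jk.
by rewrite normrM ler_pM ?hK ?hM.
Qed.

Lemma boundedX u n : bounded_family u -> bounded_family (fun k j => u k j ^+ n).
Proof.
move=> hu; elim: n => [|n IH]; first exact: bounded_family_cst.
by apply: (@bounded_eq _ (fun k j => u k j * u k j ^+ n)) => [*|];
  [rewrite exprS | apply: boundedM].
Qed.

Lemma small_eq u v :
  (forall k j, (2 <= k)%N -> (j <= k)%N -> u k j = v k j) ->
  small_family v -> small_family u.
Proof. by move=> uv; apply: bounded_eq => k j k2 jk; rewrite uv. Qed.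

Lemma smallD u v : small_family u -> small_family v ->
  small_family (fun k j => u k j + v k j).
Proof.
by move=> hu hv; apply: bounded_eq (boundedD hu hv) => k j _ _; rewrite mulrDr.
Qed.

Lemma smallN u : small_family u -> small_family (fun k j => - u k j).
Proof. by move=> hu; apply: bounded_eq (boundedN hu) => k j _ _; rewrite mulrN. Qed.

Lemma smallM u v : small_family u -> bounded_family v ->
  small_family (fun k j => u k j * v k j).
Proof.
by move=> hu hv; apply: bounded_eq (boundedM hu hv) => k j _ _; rewrite mulrA.
Qed.

Lemma smallMl u v : bounded_family u -> small_family v ->
  small_family (fun k j => u k j * v k j).
Proof.
by move=> hu hv; apply: bounded_eq (boundedM hu hv) => k j _ _; rewrite mulrCA.
Qed.

Lemma small_bounded u : small_family u -> bounded_family u.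
Proof.
move=> [K hK]; exists K => k j k2 jk; apply: le_trans (hK k j k2 jk).
by rewrite normrM ler_peMl // normr_nat ler1n (leq_trans _ k2).
Qed.

Lemma small_inv u : bounded_family u -> small_family (fun k j => k%:R^-1 * u k j).
Proof.
move=> hu; apply: bounded_eq hu => k j k2 _.
by rewrite mulrA mulfV ?mul1r // pnatr_eq0 -lt0n (leq_trans _ k2).
Qed.

Lemma close_families_refl u : close_families u u.
Proof.
apply: (@bounded_eq _ (fun _ _ => 0)) (bounded_family_cst 0) => k j _ _.
by rewrite subrr mulr0.
Qed.

Lemma closeD u u' v v' : close_families u u' -> close_families v v' ->
  close_families (fun k j => u k j + v k j) (fun k j => u' k j + v' k j).
Proof. by move=> hu hv; apply: small_eq (smallD hu hv) => k j _ _; ring. Qed.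

Lemma close_bounded u v : close_families u v -> bounded_family v -> bounded_family u.
Proof.
move=> /small_bounded huv hv; apply: bounded_eq (boundedD huv hv) => k j _ _.
by rewrite subrK.
Qed.

Lemma closeM u u' v v' : close_families u u' -> close_families v v' ->
  bounded_family u' -> bounded_family v' ->
  close_families (fun k j => u k j * v k j) (fun k j => u' k j * v' k j).
Proof.
move=> hu hv bu bv.
apply: small_eq (smallD (smallM hu (close_bounded hv bv)) (smallMl bu hv)).
by move=> k j _ _; ring.
Qed.

Lemma bounded_mean u : bounded_family u ->
  bounded_family (fun k _ => k%:R^-1 * \sum_(i < k.+1) u k i).
Proof.
move=> [K hK]; exists (2 * K) => k j k2 _.
have k0 : 0 < k%:R :> R by rewrite ltr0n (leq_trans _ k2).
have K0 : 0 <= K by apply: le_trans (hK 2%N 0%N _ _).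
rewrite normrM normfV normr_nat ler_pdivrMl //.
apply: le_trans (ler_norm_sum _ _ _) _.
apply: le_trans (_ : \sum_(i < k.+1) K <= _).
  by apply: ler_sum => i _; rewrite hK // -ltnS.
rewrite sumr_const card_ord -mulr_natr -natr1.
have k1 : 1 <= k%:R :> R by rewrite ler1n (leq_trans _ k2).
have := mulr_ge0 K0 (_ : 0 <= k%:R - 1 :> R); rewrite subr_ge0 => /(_ k1); lra.
Qed.

Lemma bounded_sum_small u : small_family u ->
  bounded_family (fun k _ => \sum_(i < k.+1) u k i).
Proof.
move=> /bounded_mean hu; apply: bounded_eq hu => k j k2 _.
rewrite mulr_sumr; apply: eq_bigr => i _; rewrite mulrA mulVf ?mul1r //.
by rewrite pnatr_eq0 -lt0n (leq_trans _ k2).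
Qed.

Lemma small_sum u : bounded_family (fun k j => k%:R ^+ 2 * u k j) ->
  small_family (fun k _ => \sum_(i < k.+1) u k i).
Proof.
move=> /bounded_mean hu; apply: bounded_eq hu => k j k2 _.
have k0 : k%:R != 0 :> R by rewrite pnatr_eq0 -lt0n (leq_trans _ k2).
by rewrite !mulr_sumr; apply: eq_bigr => i _; field.
Qed.

Lemma small_shift (u : nat -> R) : small_family (fun k _ => u k) ->
  small_family (fun k _ => u k.+1).
Proof.
move=> [K hK]; exists K => k j k2 _.
apply: le_trans (hK k.+1 0%N (leqW k2) isT).
by rewrite !normrM ler_wpM2r // !normr_nat ler_nat.
Qed.

Lemma pow_increment_bounds (n : nat) (x : R) : 0 <= x ->
  n.+1%:R * x ^+ n <= (x + 1) ^+ n.+1 - x ^+ n.+1 <= n.+1%:R * (x + 1) ^+ n.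
Proof.
move=> x0; have y0 : 0 <= x + 1 by rewrite addr_ge0.
have xy : x <= x + 1 by rewrite lerDl.
have cst (c : R) : n.+1%:R * c = \sum_(i < n.+1) c.
  by rewrite sumr_const card_ord mulr_natl.
have split_pow (z : R) i : (i <= n)%N -> z ^+ n = z ^+ (n - i) * z ^+ i.
  by move=> le_in; rewrite -exprD subnK.
have -> : (x + 1) ^+ n.+1 - x ^+ n.+1 =
    \sum_(i < n.+1) (x + 1) ^+ (n - i) * x ^+ i.
  rewrite subrXX addrAC subrr add0r mul1r.
  by apply: eq_bigr => i _.
rewrite (cst (x ^+ n)) (cst ((x + 1) ^+ n)).
apply/andP; split; apply: ler_sum => i _;
  have le_in : (i <= n)%N by rewrite -ltnS.
  by rewrite (split_pow x i) // ler_wpM2r ?exprn_ge0 // lerXn2r.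
by rewrite (split_pow (x + 1) i) // ler_wpM2l ?exprn_ge0 // lerXn2r.
Qed.

(** Comparison of a power sum with an integral, by telescoping. *)
Lemma sum_pow_bounds (n k : nat) :
  (k%:R ^+ n.+1 : R) <= n.+1%:R * \sum_(i < k.+1) (i%:R : R) ^+ n
    <= k%:R ^+ n.+1 + n.+1%:R * k%:R ^+ n.
Proof.
elim: k => [|k /andP[IH1 IH2]].
  rewrite big_ord_recl big_ord0 addr0 /= exprS mul0r add0r lexx andbT.
  by rewrite mulr_ge0 ?exprn_ge0 ?ler0n.
have /andP[] := pow_increment_bounds n (ler0n R k).
rewrite big_ord_recr /= mulrDr natr1.
set a := n.+1%:R * k%:R ^+ n in IH2 *; set b := n.+1%:R * k.+1%:R ^+ n.
set S := n.+1%:R * \sum_(_ < _) _ in IH1 IH2 *.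
set x := k%:R ^+ n.+1 in IH1 IH2 *; set y := k.+1%:R ^+ n.+1.
move: IH1 IH2; clear; move: a b S x y => a b S x y h1 h2 h3 h4.
by apply/andP; split; lra.
Qed.

Lemma bounded_sum_pow n :
  bounded_family (fun k _ =>
    \sum_(i < k.+1) (i%:R / k%:R : R) ^+ n - k%:R / n.+1%:R).
Proof.
exists 1 => k j k2 _.
have k0 : 0 < k%:R :> R by rewrite ltr0n (leq_trans _ k2).
have -> : \sum_(i < k.+1) (i%:R / k%:R : R) ^+ n =
    (\sum_(i < k.+1) (i%:R : R) ^+ n) / k%:R ^+ n.
  by rewrite mulr_suml; apply: eq_bigr => i _; rewrite expr_div_n.
have /andP[b1 b2] := sum_pow_bounds n k.
set S := \sum_(_ < _) _ in b1 b2 *.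
have kn : 0 < k%:R ^+ n :> R by rewrite exprn_gt0.
have n0 : 0 < n.+1%:R :> R by rewrite ltr0n.
have -> : S / k%:R ^+ n - k%:R / n.+1%:R =
    (n.+1%:R * S - k%:R ^+ n.+1) / (n.+1%:R * k%:R ^+ n).
  by rewrite exprS; field; rewrite !gt_eqF.
rewrite ger0_norm; last by rewrite divr_ge0 ?subr_ge0 // ltW // mulr_gt0.
by rewrite ler_pdivrMr ?mulr_gt0 // mul1r; lra.
Qed.

End Asymptotics.

(** * Growth of the power sums *)

Ltac bounded_tac := repeat first
  [ assumption | exact: bounded_family_cst | apply: boundedD | apply: boundedN
  | apply: boundedM | apply: boundedX ].

(** The increments of the second power sum determine the limit of [c k], hence
   the growth of the fourth one. *)
Lemma recurrence_power_sum_growth (R : realType) (S1 S2 S4 b c : nat -> R)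
    (m1 m2 g2 g4 : R) :
  small_family (fun k _ => S1 k - m1) ->
  small_family (fun k _ => S2 k - (g2 * k%:R + m2)) ->
  bounded_family (fun k _ => S4 k - g4 * k%:R) ->
  (forall k, (2 <= k)%N -> S1 k.+1 - S1 k = b k) ->
  (forall k, (2 <= k)%N -> S2 k.+1 - S2 k = b k ^+ 2 + 2 * c k) ->
  (forall k, (2 <= k)%N -> S4 k.+2 - S4 k.+1 =
     b k.+1 ^+ 4 + 4 * c k.+1 * (b k.+1 ^+ 2 + b k.+1 * b k + b k ^+ 2) +
     2 * c k.+1 ^+ 2 + 4 * c k.+1 * c k) ->
  2 * g4 = 3 * g2 ^+ 2.
Proof.
move=> h1 h2 h4 r1 r2 r4.
have hb : small_family (fun k _ => b k).
  apply: small_eq (smallD (small_shift h1) (smallN h1)) => k _ k2 _.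
  by rewrite -r1 //; ring.
have hc : close_families (fun k _ => c k) (fun _ _ => g2 / 2).
  have e : small_family (fun k _ => (b k * b k) * (- (1 / 2) : R)).
    exact: (smallM (smallM hb (small_bounded hb)) (bounded_family_cst _)).
  apply: small_eq (smallD (smallM (smallD (small_shift h2) (smallN h2))
    (bounded_family_cst (1 / 2))) e) => k _ k2 _.
  have := r2 k k2; rewrite -natr1 => E.
  have -> : c k = (S2 k.+1 - S2 k) / 2 - b k ^+ 2 / 2 by rewrite E; field.
  by field.
have hc' : close_families (fun k _ => c k.+1) (fun _ _ => g2 / 2).
  exact: (small_shift (u := fun k => c k - g2 / 2)).
have bc := close_bounded hc (bounded_family_cst _).
have bc' := close_bounded hc' (bounded_family_cst _).
have hb' := small_shift hb.
have bb := small_bounded hb; have bb' := small_bounded hb'.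
have bg : bounded_family (fun _ _ => g2 / 2) by exact: bounded_family_cst.
have hD : small_family (fun k _ => S4 k.+2 - S4 k.+1 - 3 / 2 * g2 ^+ 2).
  have t1 : small_family (fun k _ => b k.+1 * (b k.+1 ^+ 3 +
      4 * c k.+1 * (b k.+1 + b k))).
    by apply: (smallM hb'); bounded_tac.
  have t2 : small_family (fun k _ => b k * (4 * c k.+1 * b k)).
    by apply: (smallM hb); bounded_tac.
  have t3 : close_families
     (fun k _ => 2 * (c k.+1 * c k.+1) + 4 * (c k.+1 * c k))
     (fun _ _ => 2 * (g2 / 2 * (g2 / 2)) + 4 * (g2 / 2 * (g2 / 2))).
    have cst (x : R) : close_families (fun _ _ => x) (fun _ _ => x).
      exact: close_families_refl.
    have bst (x : R) := bounded_family_cst x.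
    exact: (closeD
      (closeM (cst 2) (closeM hc' hc' bg bg) (bst _) (boundedM bg bg))
      (closeM (cst 4) (closeM hc' hc bg bg) (bst _) (boundedM bg bg))).
  apply: small_eq (smallD (smallD t1 t2) t3) => k _ k2 _.
  by rewrite r4 //; field.
have [K hK] := hD.
have [M hM] := h4.
have K0 : 0 <= K by apply: le_trans (hK 2%N 0%N _ _).
pose d := g4 - 3 / 2 * g2 ^+ 2.
(* Between [m] and [2 * m] errors of order [1 / k] add up to a bounded one, so
   that no logarithm appears. *)
have bound m : (2 <= m)%N -> `|d| * m%:R <= K + 2 * M.
  move=> le2m.
  have tele n : S4 (m + n).+1 - S4 m.+1 - 3 / 2 * g2 ^+ 2 * n%:R =
      \sum_(i < n) (S4 (m + i).+2 - S4 (m + i).+1 - 3 / 2 * g2 ^+ 2).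
    elim: n => [|n IH]; first by rewrite big_ord0 addn0 mulr0 subrr subr0.
    by rewrite big_ord_recr /= -IH addnS -natr1; ring.
  have m0 : 0 < m%:R :> R by rewrite ltr0n (leq_trans _ le2m).
  have hs :
      `|\sum_(i < m) (S4 (m + i).+2 - S4 (m + i).+1 - 3 / 2 * g2 ^+ 2)| <= K.
    apply: le_trans (ler_norm_sum _ _ _) _.
    apply: le_trans (_ : \sum_(i < m) K / m%:R <= _); last first.
      by rewrite sumr_const card_ord -[X in X <= _]mulr_natr divfK ?gt_eqF.
    apply: ler_sum => i _; rewrite ler_pdivlMr // mulrC.
    apply: le_trans (hK (m + i)%N 0%N _ _); rewrite ?(leq_trans le2m) ?leq_addr //.
    by rewrite normrM normr_nat ler_wpM2r // ler_nat leq_addr.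
  rewrite -tele in hs.
  have h5 := hM (m + m).+1 0%N (leqW (leq_trans le2m (leq_addr _ _))) isT.
  have h6 := hM m.+1 0%N (leqW le2m) isT.
  rewrite -[m%:R]gtr0_norm // -normrM.
  have -> : d * m%:R = (S4 (m + m).+1 - S4 m.+1 - 3 / 2 * g2 ^+ 2 * m%:R) -
      (S4 (m + m).+1 - g4 * (m + m).+1%:R) + (S4 m.+1 - g4 * m.+1%:R).
    by rewrite /d -[(m + m).+1%:R]natr1 -[m.+1%:R]natr1 natrD; ring.
  apply: le_trans (ler_normD _ _) _.
  apply: le_trans (lerD (ler_normB _ _) (lexx _)) _.
  lra.
have [d0|d0] := eqVneq d 0; first by move: d0; rewrite /d; lra.
have nd : 0 < `|d| by rewrite normr_gt0.
pose N := Num.bound ((K + 2 * M) / `|d|).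
have := bound N.+2 isT.
have KM : 0 <= K + 2 * M.
  by apply: le_trans (bound 2%N isT); rewrite mulr_ge0 ?ler0n.
have : (K + 2 * M) / `|d| < N%:R by apply: archi_boundP; rewrite divr_ge0.
rewrite ltr_pdivrMr // => h7 h8.
have : N%:R * `|d| <= `|d| * N.+2%:R.
  by rewrite mulrC ler_pM2l // ler_nat -addn2 leq_addr.
by move=> /(lt_le_trans h7) /lt_le_trans /(_ h8); rewrite ltxx.
Qed.

Section PowerSumFormulas.
Variable R : realFieldType.

Lemma sum_id (k : nat) :
  \sum_(i < k.+1) i%:R = k%:R * (k%:R + 1) / 2 :> R.
Proof.
elim: k => [|k IH]; first by rewrite big_ord1 !mul0r.
by rewrite big_ord_recr /= IH -natr1; field.
Qed.

Lemma sum_sqr (k : nat) :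
  \sum_(i < k.+1) i%:R ^+ 2 = k%:R * (k%:R + 1) * (2 * k%:R + 1) / 6 :> R.
Proof.
elim: k => [|k IH]; first by rewrite big_ord1 expr0n !mul0r.
by rewrite big_ord_recr /= IH -natr1; field.
Qed.

Lemma sum_cube (k : nat) :
  \sum_(i < k.+1) i%:R ^+ 3 = (k%:R * (k%:R + 1)) ^+ 2 / 4 :> R.
Proof.
elim: k => [|k IH]; first by rewrite big_ord1 !expr0n /= mul0r expr0n !mul0r.
by rewrite big_ord_recr /= IH -natr1; field.
Qed.

Lemma sum_pow4 (k : nat) :
  \sum_(i < k.+1) i%:R ^+ 4 =
  k%:R * (k%:R + 1) * (2 * k%:R + 1) * (3 * k%:R ^+ 2 + 3 * k%:R - 1) / 30 :> R.
Proof.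
elim: k => [|k IH]; first by rewrite big_ord1 !expr0n /= !mul0r.
by rewrite big_ord_recr /= IH -natr1; field.
Qed.

End PowerSumFormulas.

Section LameAsymptotics.
Variables (R : realType) (p q sg b1 b0 : R).
Hypothesis sg_gt0 : 0 < sg.

Local Notation B := (lame_rec_b sg b1).
Local Notation C := (lame_rec_c p sg b0).
Local Notation F := (lame_rec_f q sg).
Local Notation G := (lame_rec_poly p q sg b1 b0).

(** The increment given by [power_sum4_rec], indexed by [j = k - s]. *)
Definition trace4_term (k j : nat) : R :=
  B k j ^+ 4 + 4 * C k j * (B k j ^+ 2 + B k j * B k j.+1 + B k j.+1 ^+ 2) +
  2 * C k j ^+ 2 + 4 * C k j * C k j.+1 +
  4 * F k j * (B k j + B k j.+1 + B k j.+2).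

Lemma sum_rev (k : nat) (u : nat -> R) :
  \sum_(s < k.+1) u (k - s)%N = \sum_(j < k.+1) u j.
Proof.
rewrite (reindex_inj rev_ord_inj) /=; apply: eq_bigr => j _.
by rewrite subSS subKn // -ltnS.
Qed.

Lemma telescope_from0 (n : nat) (S u : nat -> R) : S 0%N = 0 ->
  (forall s, (s < n)%N -> S s.+1 - S s = u s) -> S n = \sum_(s < n) u s.
Proof.
move=> S0 Su; have := telescope_sumr S (leq0n n); rewrite S0 subr0 => <-.
by rewrite big_mkord; apply: eq_bigr => s _; rewrite Su.
Qed.

Let G_monic k s : G k s \is monic.
Proof. by have [] := rec_poly_monic_size (fun s => B k (k - s))
  (fun s => C k (k - s)) (fun s => F k (k - s)) s. Qed.

Let size_G k s : size (G k s) = s.+1.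
Proof. by have [] := rec_poly_monic_size (fun s => B k (k - s))
  (fun s => C k (k - s)) (fun s => F k (k - s)) s. Qed.

Lemma lame_power_sum1 k : (1 <= k)%N ->
  power_sum1 k.+1 (G k k.+1) = \sum_(j < k.+1) B k j.
Proof.
move=> k1; rewrite -(sum_rev k (B k)).
apply: (@telescope_from0 k.+1 (fun s => power_sum1 s (G k s))
  (fun s => B k (k - s))) => [|s _].
  by rewrite /power_sum1 /top_coef /= oppr0.
exact: (power_sum1_rec (G_monic k) (size_G k)
  (lame_rec_poly_step p q sg b1 b0 s k1)).
Qed.

Lemma lame_power_sum2 k : (1 <= k)%N ->
  power_sum2 k.+1 (G k k.+1) = \sum_(j < k.+1) (B k j ^+ 2 + 2 * C k j).
Proof.
move=> k1; rewrite -(sum_rev k (fun j => B k j ^+ 2 + 2 * C k j)).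
apply: (@telescope_from0 k.+1 (fun s => power_sum2 s (G k s))
  (fun s => B k (k - s) ^+ 2 + 2 * C k (k - s))) => [|s _].
  by rewrite /power_sum2 /top_coef /= expr0n mulr0 subr0.
exact: (power_sum2_rec (G_monic k) (size_G k)
  (lame_rec_poly_step p q sg b1 b0 s k1)).
Qed.

Lemma lame_power_sum4 k : (1 <= k)%N ->
  power_sum4 k.+1 (G k k.+1) = \sum_(j < k.+1) trace4_term k j.
Proof.
move=> k1; rewrite -(sum_rev k (trace4_term k)).
apply: (@telescope_from0 k.+1 (fun s => power_sum4 s (G k s))
  (fun s => trace4_term k (k - s))) => [|s sk].
  by rewrite /power_sum4 /top_coef /= !expr0n /= !(mulr0, mul0r) !subr0 !addr0.
have st n := lame_rec_poly_step p q sg b1 b0 n k1.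
rewrite (power_sum4_rec (G_monic k) (size_G k) (st s)) //.
rewrite /trace4_term.
have [s0|s0] := posnP s.
  have [_ c0 f0] := st s; rewrite c0 // f0 ?s0 //.
  by rewrite !(mulr0, mul0r, expr0n, addr0).
have e1 : (k - s.-1)%N = (k - s).+1 by move: sk; lia.
rewrite e1; have [s1|s1] := leqP s 1.
  by have [_ _ f0] := st s; rewrite f0 // !(mulr0, mul0r).
by have -> : (k - s.-2)%N = (k - s).+2 by move: sk; lia.
Qed.

(* With [mu k = k ^ 2 / y], the coefficients of the recurrence are polynomials in
   [h = 1 / k], [x = j / k] and [y], where [y] is close to [1]; so they are
   close to polynomials in [x] alone. *)
Let mu := lame_eigenvalue sg.
Let t := sg - 1.
Let h (k j : nat) : R := k%:R^-1.
Let x (k j : nat) : R := j%:R / k%:R.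
Let y (k j : nat) : R := k%:R / (k%:R + t).

Let k_gt0 k : (2 <= k)%N -> 0 < k%:R :> R.
Proof. by move=> k2; rewrite ltr0n (leq_trans _ k2). Qed.

Let kt_gt0 k : (2 <= k)%N -> k%:R / 2 <= k%:R + t :> R.
Proof.
move=> k2; have : 2 <= k%:R :> R by rewrite (ler_nat _ 2).
by rewrite /t; move: sg_gt0; lra.
Qed.

Let k_neq0 k : (2 <= k)%N -> k%:R != 0 :> R.
Proof. by move=> /k_gt0; apply: lt0r_neq0. Qed.

Let kt_neq0 k : (2 <= k)%N -> k%:R + t != 0.
Proof.
move=> k2; apply: lt0r_neq0; apply: lt_le_trans (kt_gt0 k2).
by rewrite divr_gt0 // k_gt0.
Qed.

Let bh : bounded_family h.
Proof.
exists 1 => k j k2 _; rewrite /h normfV normr_nat invf_le1 ?k_gt0 //.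
by rewrite ler1n (leq_trans _ k2).
Qed.

Let bx : bounded_family x.
Proof.
exists 1 => k j k2 jk; rewrite /x normrM normfV !normr_nat.
by rewrite ler_pdivrMr ?k_gt0 // mul1r ler_nat.
Qed.

Let bY : bounded_family y.
Proof.
exists 2 => k j k2 jk; rewrite /y.
have k0 := k_gt0 k2; have kt := kt_gt0 k2.
have kt0 : 0 < k%:R + t by apply: lt_le_trans kt; rewrite divr_gt0.
have y0 : 0 <= k%:R / (k%:R + t) by rewrite divr_ge0 // ltW.
rewrite ger0_norm // ler_pdivrMr //.
by move: kt; lra.
Qed.

Let small_h u : bounded_family u -> small_family (fun k j => h k j * u k j).
Proof. exact: small_inv. Qed.

Let y1 : close_families y (fun _ _ => 1).
Proof.
apply: (@small_eq _ _ (fun k j => h k j * (- t * y k j))) => [k j k2 _|].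
  rewrite /h /y; have := k_neq0 k2; have := kt_neq0 k2.
  by move=> *; field; apply/andP.
by apply: small_h; bounded_tac.
Qed.

Let BE k j : (2 <= k)%N -> B k j = h k j * (- (x k j * b1 * y k j)).
Proof.
move=> k2; rewrite /lame_rec_b /lame_eigenvalue /h /x /y.
rewrite -addrA [-1 + _]addrC -/t.
by have := k_neq0 k2; have := kt_neq0 k2; move=> *; field; apply/andP.
Qed.

(* The differences [mu k - mu j] and [mu k - mu j.+1], divided by [k ^ 2]. *)
Let gap (k j : nat) : R := 1 + t * h k j - x k j ^+ 2 - t * h k j * x k j.
Let gap' (k j : nat) : R :=
  1 + t * h k j - (x k j + h k j) ^+ 2 - t * h k j * (x k j + h k j).

Let CE k j : (2 <= k)%N ->
  C k j = - ((x k j + h k j) * (x k j * p + h k j * b0) * gap k j * y k j ^+ 2).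
Proof.
move=> k2; rewrite /lame_rec_c /lame_eigenvalue /gap /h /x /y.
rewrite -!addrA ![-1 + _]addrC -/t.
by have := k_neq0 k2; have := kt_neq0 k2; move=> *; field; apply/andP.
Qed.

Let CE' k j : (2 <= k)%N ->
  C k j.+1 = - ((x k j + h k j + h k j) * ((x k j + h k j) * p + h k j * b0) *
    gap' k j * y k j ^+ 2).
Proof.
move=> k2; rewrite /lame_rec_c /lame_eigenvalue /gap' /h /x /y.
rewrite -!addrA ![-1 + _]addrC -/t.
rewrite -natr1.
by have := k_neq0 k2; have := kt_neq0 k2; move=> *; field; apply/andP.
Qed.

Let FE k j : (2 <= k)%N ->
  F k j = - ((x k j + h k j + h k j) * (x k j + h k j) * q * gap k j *
    gap' k j * y k j ^+ 3).
Proof.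
move=> k2; rewrite /lame_rec_f /lame_eigenvalue /gap /gap' /h /x /y.
rewrite -!addrA ![-1 + _]addrC -/t.
rewrite -natr1.
by have := k_neq0 k2; have := kt_neq0 k2; move=> *; field; apply/andP.
Qed.

Let bgap : bounded_family gap.
Proof. by rewrite /gap; bounded_tac. Qed.

Let bgap' : bounded_family gap'.
Proof. by rewrite /gap'; bounded_tac. Qed.

Let smallB : small_family (fun k j => B k j).
Proof.
by apply: small_eq (fun k j k2 _ => BE j k2) _; apply: small_h; bounded_tac.
Qed.

Let smallB' : small_family (fun k j => B k j.+1).
Proof.
apply: (@small_eq _ _ (fun k j =>
  h k j * - ((x k j + h k j) * b1 * y k j))) => [k j k2 _|].
  by rewrite BE // /x /h -natr1 mulrDl mul1r.
by apply: small_h; bounded_tac.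
Qed.

Let smallB'' : small_family (fun k j => B k j.+2).
Proof.
apply: (@small_eq _ _ (fun k j =>
  h k j * - ((x k j + h k j + h k j) * b1 * y k j))) => [k j k2 _|].
  by rewrite BE // /x /h -natr1 -natr1 !mulrDl mul1r.
by apply: small_h; bounded_tac.
Qed.

Let C_lim (k j : nat) : R := - (x k j * (x k j * p) * (1 - x k j ^+ 2)).

Let bC_lim : bounded_family C_lim.
Proof. by rewrite /C_lim; bounded_tac. Qed.

Let closeC : close_families (fun k j => C k j) C_lim.
Proof.
have sY : small_family (fun k j => (y k j - 1) *
    - ((x k j + h k j) * (x k j * p + h k j * b0) * gap k j * (y k j + 1))).
  by apply: (smallM y1); bounded_tac.
have sH : small_family (fun k j => h k j *
    - ((x k j * p + h k j * b0) * gap k j +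
    x k j * b0 * gap k j + x k j * (x k j * p) * t * (1 - x k j))).
  by apply: small_h; bounded_tac.
by apply: small_eq (smallD sY sH) => k j k2 _; rewrite CE // /C_lim /gap; ring.
Qed.

Let closeC' : close_families (fun k j => C k j.+1) C_lim.
Proof.
have sY : small_family (fun k j => (y k j - 1) *
    - ((x k j + h k j + h k j) * ((x k j + h k j) * p + h k j * b0) *
       gap' k j * (y k j + 1))).
  by apply: (smallM y1); bounded_tac.
have sH : small_family (fun k j => h k j *
    - (2 * ((x k j + h k j) * p + h k j * b0) * gap' k j +
    x k j * (p + b0) * gap' k j +
    x k j * (x k j * p) * (t * (1 - x k j - h k j) - 2 * x k j - h k j))).
  by apply: small_h; bounded_tac.
by apply: small_eq (smallD sY sH) => k j k2 _; rewrite CE' // /C_lim /gap'; ring.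
Qed.

Let bF : bounded_family (fun k j => F k j).
Proof. by apply: bounded_eq (fun k j k2 _ => FE j k2) _; bounded_tac. Qed.


Let close_trace4 : close_families (fun k j => trace4_term k j)
  (fun k j => 6 * (C_lim k j * C_lim k j)).
Proof.
have bB := small_bounded smallB; have bB' := small_bounded smallB'.
have bB'' := small_bounded smallB''.
have bC := close_bounded closeC bC_lim; have bC' := close_bounded closeC' bC_lim.
have t1 : small_family (fun k j => B k j *
    (B k j ^+ 3 + 4 * C k j * (B k j + B k j.+1) + 4 * F k j)).
  by apply: (smallM smallB); bounded_tac.
have t2 : small_family (fun k j =>
    B k j.+1 * (4 * C k j * B k j.+1 + 4 * F k j)).
  by apply: (smallM smallB'); bounded_tac.
have t3 : small_family (fun k j => B k j.+2 * (4 * F k j)).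
  by apply: (smallM smallB''); bounded_tac.
have t4 := smallM (closeM closeC closeC bC_lim bC_lim)
  (bounded_family_cst (2 : R)).
have t5 := smallM (closeM closeC closeC' bC_lim bC_lim)
  (bounded_family_cst (4 : R)).
apply: small_eq (smallD (smallD (smallD t1 t2) t3) (smallD t4 t5)) => k j _ _.
by rewrite /trace4_term; ring.
Qed.

(** The leading coefficient is [6 * \int_0^1 (p x^2 (1 - x^2))^2 dx]: a sum over
   [j] of values of a polynomial in [x = j / k] is [k] times its integral, up to
   a bounded error. *)
Lemma lame_power_sum4_growth :
  bounded_family (fun k _ =>
    power_sum4 k.+1 (G k k.+1) - 16 / 105 * p ^+ 2 * k%:R).
Proof.
have h1 := bounded_sum_small close_trace4.
have hn n := boundedM (bounded_family_cst (6 * p ^+ 2 : R))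
  (@bounded_sum_pow R n).
apply: bounded_eq (boundedD h1 (boundedD (hn 4) (boundedD (boundedM
  (bounded_family_cst (- 2)) (hn 6)) (hn 8)))) => k j k2 _.
rewrite lame_power_sum4 ?(leq_trans _ k2) // sumrB.
have -> : \sum_(i < k.+1) 6 * (C_lim k i * C_lim k i) = 6 * p ^+ 2 *
   (\sum_(i < k.+1) (i%:R / k%:R) ^+ 4 -
    2 * \sum_(i < k.+1) (i%:R / k%:R) ^+ 6 +
    \sum_(i < k.+1) (i%:R / k%:R) ^+ 8).
  rewrite mulr_sumr -sumrB -big_split /= mulr_sumr; apply: eq_bigr => i _.
  by rewrite /C_lim /x; ring.
by field.
Qed.

Lemma lame_power_sum1_growth :
  small_family (fun k _ => power_sum1 k.+1 (G k k.+1) - (- (b1 / 2))).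
Proof.
have bb : bounded_family (fun k j => - (b1 / 2) * ((1 - t) * y k j)).
  by bounded_tac.
apply: small_eq (small_h bb) => k j k2 _.
rewrite lame_power_sum1 ?(leq_trans _ k2) //.
have -> : \sum_(i < k.+1) B k i = - (b1 / mu k) * \sum_(i < k.+1) i%:R.
  by rewrite mulr_sumr; apply: eq_bigr => i _; rewrite /lame_rec_b -/mu; ring.
rewrite sum_id /mu /lame_eigenvalue -addrA [-1 + _]addrC -/t /h /y.
by have := k_neq0 k2; have := kt_neq0 k2; move=> *; field; apply/andP.
Qed.

(* The increments of the second power sum are needed up to [O(1/k)], which
   requires its constant term to be split off exactly. *)
Let lin_const : R :=
  - 2 * (t * p / 12 + (p + b0) / 4 - 4 / 15 * (t * p)).

(** The leading coefficient is [- 2 * \int_0^1 p x^2 (1 - x^2) dx]. *)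
Lemma lame_power_sum2_growth :
  small_family (fun k _ => power_sum2 k.+1 (G k k.+1) -
    (- (4 / 15) * p * k%:R + lin_const)).
Proof.
have sB : small_family (fun k _ => \sum_(j < k.+1) B k j ^+ 2).
  apply: (@small_sum _ (fun k j => B k j ^+ 2)).
  apply: (@bounded_eq _ _ (fun k j => (x k j * b1 * y k j) ^+ 2)); last first.
    by bounded_tac.
  by move=> k j k2 _; rewrite BE // /h; have := k_neq0 k2 => *; field.
(* Minus the sum of the [C k j] over [j], divided by [k * y ^ 2], is a polynomial
   in [h]; [rem] is what is left of it, divided by [h ^ 2], when the leading
   terms [2 / 15 * p - lin_const / 2 * h], times [y ^ -2], are removed. *)
pose rem k j :=
  (2 / 3 * b0 - p / 6 - t * b0 / 3 - t * p / 3 + 7 / 30 * (t ^+ 2 * p))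
  + (b0 / 4 - p / 4 + t * b0 / 2 - t * p / 12 - t ^+ 2 * b0 / 4 - t ^+ 2 * p / 4
     + 11 / 60 * (t ^+ 3 * p)) * h k j
  + (- (b0 / 6) + p / 30 + t * b0 / 3 - t * p / 6) * h k j ^+ 2.
have bb : bounded_family (fun k j => - 2 * (y k j ^+ 2 * rem k j)).
  by rewrite /rem; bounded_tac.
apply: small_eq (smallD sB (small_h bb)) => k j k2 _.
rewrite lame_power_sum2 ?(leq_trans _ k2) // big_split /= -addrA; congr (_ + _).
have -> : \sum_(i < k.+1) 2 * C k i = - 2 / mu k ^+ 2 *
   (b0 * mu k * k.+1%:R + (mu k * (p + b0) - t * b0) * \sum_(i < k.+1) i%:R +
    (mu k * p - b0 - t * (p + b0)) * \sum_(i < k.+1) i%:R ^+ 2 -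
    (p + b0 + t * p) * \sum_(i < k.+1) i%:R ^+ 3 -
    p * \sum_(i < k.+1) i%:R ^+ 4).
  have -> : b0 * mu k * k.+1%:R = \sum_(i < k.+1) (b0 * mu k).
    by rewrite sumr_const card_ord mulr_natr.
  rewrite !mulr_sumr -!sumrN -!big_split /= mulr_sumr; apply: eq_bigr => i _.
  rewrite /lame_rec_c -/mu.
  have -> : mu i = i%:R * (i%:R + t) by rewrite /mu /lame_eigenvalue /t; ring.
  by ring.
rewrite sum_id sum_sqr sum_cube sum_pow4 -natr1.
have -> : mu k = k%:R * (k%:R + t) by rewrite /mu /lame_eigenvalue /t; ring.
rewrite /lin_const /h /y /rem /h.
by have := k_neq0 k2; have := kt_neq0 k2; move=> *; field; apply/andP.
Qed.

End LameAsymptotics.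

(** * The two cases *)

Lemma integrable_horner (R : realType)
    (m : {measure set (measurableTypeR R) -> \bar R}) (q : {poly R}) :
  (forall j : nat, m.-integrable [set: R] (fun x : R => (x ^+ j)%:E)) ->
  m.-integrable [set: R] (EFin \o horner q).
Proof.
move=> hint.
have mT : measurable [set: measurableTypeR R] by exact: measurableT.
have := @integrable_sum _ _ _ m _ mT _ (index_enum 'I_(size q)) xpredT
  (fun i x => (q`_i)%:E * ((x : R) ^+ i)%:E)%E
  (fun i _ => integrableZl mT _ (hint i)).
apply: eq_integrable => // x _ /=; rewrite horner_coef -sumEFin.
by apply: eq_bigr => i _; rewrite EFinM.
Qed.

(** The first two power sums determine the limits of [b] and [c], hence the growth
   of the fourth power sum; it does not match the growth computed from the Lame
   equation unless all three singular points coincide. *)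
Lemma no_three_term_recurrence (R : realType) (alpha rho : 'I_3 -> R)
    (nu : forall k : nat, 'I_k.+1 -> R) (b c : nat -> R) :
  (forall i j : 'I_3, (i < j)%N -> alpha i < alpha j) ->
  (forall j : 'I_3, 0 < rho j) ->
  (forall k : nat, (1 <= k)%N -> van_vleck_zeros alpha rho (nu k)) ->
  ~ forall k, (2 <= k)%N -> spectral_poly (nu k.+1) =
      ('X - (b k)%:P) * spectral_poly (nu k) -
      c k *: spectral_poly (nu k.-1).
Proof.
move=> halpha hrho hnu rec.
pose sg := \sum_(j < 3) 2 * rho j.
have sg0 : 0 < sg.
  rewrite /sg !big_ord_recl big_ord0 addr0.
  by rewrite !addr_gt0 // mulr_gt0.
pose x0 := alpha ord0; pose x1 := alpha (lift ord0 ord0).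
pose x2 := alpha (lift ord0 (lift ord0 ord0)).
pose m := (x0 + x1 + x2) / 3.
have [b1 [b0 EB]] : exists b1 b0, lame_B (fun j => alpha j - m) rho =
    sg *: 'X^2 + b1 *: 'X + b0%:P.
  by do 2 eexists; exact: lame_B_quadratic.
pose p := (x0 - m) * (x1 - m) + (x0 - m) * (x2 - m) + (x1 - m) * (x2 - m).
pose q := - ((x0 - m) * (x1 - m) * (x2 - m)).
have EA : lame_A (fun j => alpha j - m) = 'X^3 + 0 *: 'X^2 + p *: 'X + q%:P.
  rewrite lame_A_cubic -/x0 -/x1 -/x2 -/p -/q.
  by have -> : - (x0 - m + (x1 - m) + (x2 - m)) = 0 by rewrite /m; field.
(* The spectral polynomials, centred and listed by degree. *)
pose O n : {poly R} :=
  if n is k.+1 then spectral_poly (nu k) \Po ('X + m%:P) else 1.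
have O_monic n : O n \is monic.
  case: n => [|n]; first exact: monic1.
  rewrite monicE lead_coef_comp ?size_XaddC // lead_coefXaddC expr1n mulr1.
  exact: spectral_poly_monic.
have size_O n : size (O n) = n.+1.
  case: n => [|n]; first exact: size_poly1.
  by rewrite size_comp_poly2 ?size_XaddC // size_spectral_poly.
have OE k : (1 <= k)%N -> O k.+1 = lame_rec_poly p q sg b1 b0 k k.+1.
  by move=> k1; exact: (spectral_poly_lame_rec k1 sg0 (hnu k k1) EA EB).
have stepO k : (2 <= k)%N -> rec_step O (fun n => b n.-1 - m) (fun n => c n.-1)
    (fun _ => 0) k.+1.
  move=> k2; split=> //=; case: k k2 => [|[|k]] // k2.
  rewrite rec // !(comp_polyB, comp_polyM, comp_polyZ, comp_polyX, comp_polyC).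
  by rewrite scale0r subr0 polyCB opprB addrA.
have growth1 := lame_power_sum1_growth p q b1 b0 sg0.
have growth2 := lame_power_sum2_growth p q b1 b0 sg0.
have growth4 := lame_power_sum4_growth p q b1 b0 sg0.
have H : 2 * (16 / 105 * p ^+ 2) = 3 * (- (4 / 15) * p) ^+ 2.
  apply: (@recurrence_power_sum_growth R (fun k => power_sum1 k.+1 (O k.+1))
    (fun k => power_sum2 k.+1 (O k.+1)) (fun k => power_sum4 k.+1 (O k.+1))
    (fun k => b k - m) c _ _ _ _ (small_eq _ growth1) (small_eq _ growth2)
    (bounded_eq _ growth4)).
  - by move=> k _ k2 _; rewrite OE // (leq_trans _ k2).
  - by move=> k _ k2 _; rewrite OE // (leq_trans _ k2).
  - by move=> k _ k2 _; rewrite OE // (leq_trans _ k2).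
  - by move=> k k2; rewrite (power_sum1_rec O_monic size_O (stepO k k2)).
  - by move=> k k2; rewrite (power_sum2_rec O_monic size_O (stepO k k2)).
  - move=> k k2; rewrite (power_sum4_rec O_monic size_O (stepO k.+1 (leqW k2))).
    + by rewrite mulr0 mul0r addr0.
    + by move=> _; exact: stepO.
    + by rewrite eqxx.
have /eqP : p ^+ 2 = 0 by move: H; lra.
rewrite sqrf_eq0 => /eqP p0.
have x01 : x0 < x1 by exact: halpha.
have sq : (x0 - m) ^+ 2 + (x1 - m) ^+ 2 + (x2 - m) ^+ 2 = 0.
  transitivity ((x0 - m + (x1 - m) + (x2 - m)) ^+ 2 - 2 * p).
    by rewrite /p; ring.
  by rewrite p0 /m; field.
move: sq => /eqP; rewrite !paddr_eq0 ?addr_ge0 ?sqr_ge0 // !sqrf_eq0 !subr_eq0.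
by move=> /andP[/andP[/eqP h0 /eqP h1] _]; move: x01; rewrite h0 h1 ltxx.
Qed.

Theorem theorem3p1 (R : realType) (alpha rho : 'I_3 -> R)
    (halpha : forall i j : 'I_3, (i < j)%N -> alpha i < alpha j)
    (hrho : forall j : 'I_3, 0 < rho j)
    (nu : forall k : nat, 'I_k.+1 -> R)
    (hnu : forall k : nat, (1 <= k)%N -> van_vleck_zeros alpha rho (nu k)) :
  ~ exists m : {measure set (measurableTypeR R) -> \bar R},
      [/\ m [set: R] != 0%E,
          forall j : nat, m.-integrable [set: R] (fun x : R => (x ^+ j)%:E)
        & forall k : nat, (1 <= k)%N ->
          forall q : {poly R}, (size q <= k.+1)%N ->
            (\int[m]_(x in [set: R])
               ((spectral_poly (nu k)).[x] * q.[x])%:E = 0)%E].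
Proof.
move=> [m [m0 hint horth]].
have mT : measurable [set: measurableTypeR R] by exact: measurableT.
pose L0 (q : {poly R}) : R := (\int[m]_(x in [set: R]) q.[x])%R.
have L0_lin : linear_for *%R L0.
  move=> a u v; rewrite /L0 -RintegralZl //; last exact: integrable_horner.
  rewrite -RintegralD //; last exact: integrable_horner; last first.
    have := integrable_horner (a *: u) hint; apply: eq_integrable => // x _ /=.
    by rewrite hornerZ.
  by apply: eq_Rintegral => x _; rewrite hornerD hornerZ.
pose L : {scalar {poly R}} :=
  HB.pack L0 (GRing.isLinear.Build R {poly R} R *%R L0 L0_lin).
have L_sqr_ge0 (q : {poly R}) : 0 <= L (q * q).
  by apply: Rintegral_ge0 => x _; rewrite hornerM -expr2 sqr_ge0.
have L1 : L 1 != 0.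
  have -> : L 1 = fine (m [set: R]).
    rewrite -[RHS]mul1r -(Rintegral_cst m mT).
    by apply: eq_Rintegral => x _; rewrite hornerC.
  have m_fin : (m [set: R] < +oo)%E.
    have := integrable_lty mT (hint 0%N).
    by rewrite (eq_integral (cst 1%E)) // integral_cst // mul1e.
  by rewrite fine_eq0 // ge0_fin_numE.
pose P k := spectral_poly (nu k).
have P_monic k : P k \is monic by exact: spectral_poly_monic.
have size_P k : size (P k) = k.+2 by exact: size_spectral_poly.
have L_orth k : (1 <= k)%N ->
    forall q : {poly R}, (size q <= k.+1)%N -> L (P k * q) = 0.
  move=> k1 q sq; rewrite -[RHS]/(fine 0%E) -(horth k k1 q sq).
  by congr fine; apply: eq_integral => x _; rewrite hornerM.
have [Ldef|] := pselect (forall q, L (q * q) = 0 -> q = 0).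
  have /choice[bc hbc] : forall k, exists bc : R * R, (2 <= k)%N ->
      P k.+1 = ('X - bc.1%:P) * P k - bc.2 *: P k.-1.
    move=> k; have [k2|k2] := leqP 2 k; last by exists (0, 0).
    have [b [c E]] := three_term_recurrence P_monic size_P L_orth Ldef k2.
    by exists (b, c).
  exact: (@no_three_term_recurrence R alpha rho nu (fun k => (bc k).1)
    (fun k => (bc k).2) halpha hrho hnu).
move=> /existsNP[r0 /not_implyP[Lr0 /eqP r0n0]].
have [r [szr rdvd]] := degenerate_common_divisor L_sqr_ge0 L_orth L1 r0n0 Lr0.
pose K := size r.
have [a ra] : exists a, root r a.
  apply: (common_root_of_divisor szr (rdvd K _ _)) => //; exact: ltnW.
have vv k : (K <= k)%N -> van_vleck_zero alpha rho k (real_complex R a).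
  move=> Kk; have k1 : (1 <= k)%N by apply: leq_trans Kk; exact: ltnW.
  have [_ ->] := hnu k k1.
  have : root (P k) a.
    by rewrite -dvdp_XsubCl (dvdp_trans _ (rdvd k k1 Kk)) // dvdp_XsubCl.
  rewrite /root horner_prod => /prodf_eq0[i _].
  by rewrite hornerXsubC subr_eq0 => /eqP ->; exists i.
pose sg := \sum_(j < 3) 2 * rho j.
have sg0 : 0 < sg.
  rewrite /sg !big_ord_recl big_ord0 addr0.
  by rewrite !addr_gt0 // mulr_gt0.
have /choice[phi hphi] : forall k, exists phi : {poly R}, (K <= k)%N ->
    size phi = k.+1 /\ lame_solution alpha rho (lame_eigenvalue sg k) a phi.
  move=> k; have [Kk|Kk] := leqP K k; last by exists 0.
  by have [phi [_ s E]] := van_vleck_zero_real (vv k Kk); exists phi.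
apply: (@no_common_van_vleck_zero R alpha rho a K (lame_eigenvalue sg) phi) => //.
- exact: ltnW.
- move=> k Kk; have k2 : (2 <= k)%N by apply: leq_trans Kk.
  have : 2 <= k%:R :> R by rewrite (ler_nat _ 2).
  rewrite /lame_eigenvalue -natr1 => k2R.
  apply/andP; split; first by rewrite mulr_gt0 //; move: sg0; lra.
  by move: sg0; nra.
- by move=> k Kk; have [] := hphi k Kk.
- by move=> k Kk; have [] := hphi k Kk.
Qed.
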